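(* Let $d\ge1$ and $k\ge d+3$. The space $\mathfrak t_d^k$ of Tyler regular projective shapes is a differentiable Hausdorff manifold.
   Context: $\mathbb{RP}^d$ is the space of lines through the origin in $\mathbb R^{d+1}$. The group $\mathrm{PGL}(d):=\mathrm{GL}(d+1,\mathbb R)/\mathbb R^*$ acts component-wise on $A_d^k=(\mathbb{RP}^d)^k$, and $\mathfrak a_d^k=A_d^k/\mathrm{PGL}(d)$ carries the quotient topology; its elements are called shapes. A configuration $p=(p_1,\dots,p_k)\in A_d^k$ is Tyler regular if for every $j=0,\dots,d-1$, every $j$-dimensional projective subspace of $\mathbb{RP}^d$ contains fewer than $k\frac{j+1}{d+1}$ of the landmarks (counted with multiplicity, i.e. counting indices $i$ with $p_i$ in the subspace). This property is invariant under $\mathrm{PGL}(d)$, and $\mathfrak t_d^k\subseteq\mathfrak a_d^k$ is the set of shapes of Tyler regular configurations, with the subspace topology. A differentiable manifold means a second-countable, locally Euclidean topological space carrying an atlas (compatible with its topology) whose transition maps are smooth. *)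

(* Defs.v *)
From HB Require Import structures.
From mathcomp Require Import all_boot all_order all_algebra.
From mathcomp Require Import all_classical all_reals all_analysis.

Set Implicit Arguments.
Unset Strict Implicit.
Unset Printing Implicit Defensive.

Import Order.TTheory GRing.Theory Num.Theory.
Import numFieldNormedType.Exports.

Local Open Scope classical_set_scope.
Local Open Scope ring_scope.
Local Open Scope quotient_scope.

Section ProjectiveSpace.
Variables (R : realType) (d : nat).

Definition nonzero_vec : Type := set_type [set v : 'cV[R]_d.+1 | v != 0].
HB.instance Definition _ :=
  Topological.copy nonzero_vec (set_type [set v : 'cV[R]_d.+1 | v != 0]).

Definition nvec (v : nonzero_vec) : 'cV[R]_d.+1 := set_val v.

Record line := Line {
  line_vspace : {vspace 'cV[R]_d.+1};
  line_dim : \dim line_vspace == 1%N }.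

Lemma line_inj (L M : line) : line_vspace L = line_vspace M -> L = M.
Proof.
by case: L M => [L hL] [M hM] /= e; subst M; rewrite (bool_irrelevance hL hM).
Qed.

Lemma nvec_neq0 (v : nonzero_vec) : nvec v != 0.
Proof. by have := set_valP v. Qed.

Lemma dim_span_nvec (v : nonzero_vec) : \dim <[nvec v]>%VS == 1%N.
Proof. by rewrite dim_vline nvec_neq0. Qed.

Definition line_through (v : nonzero_vec) : line := Line (dim_span_nvec v).

Lemma vpick_line_neq0 (L : line) : vpick (line_vspace L) != 0.
Proof. by rewrite vpick0 -dimv_eq0 (eqP (line_dim L)). Qed.

Definition line_repr (L : line) : nonzero_vec :=
  exist _ (vpick (line_vspace L)) (mem_set (vpick_line_neq0 L)).

Lemma line_reprK : cancel line_repr line_through.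
Proof.
move=> L; apply: line_inj => /=; apply/eqP.
rewrite eqEdim -memvE memv_pick /= (eqP (line_dim L)) dim_vline.
by rewrite /nvec set_valE /= vpick_line_neq0.
Qed.

HB.instance Definition _ := isQuotient.Build nonzero_vec line line_reprK.

(* RP^d with the quotient topology of R^(d+1) \ {0}, for v |-> <[v]>. *)
Definition RP : Type := quotient_topology line.
HB.instance Definition _ := Topological.copy RP (quotient_topology line).
HB.instance Definition _ := Quotient.copy RP (quotient_topology line).

(* Not [\val]: the library views a quotient as a subtype of the quotiented
   type, so that [\val p] would be a representative vector of [p]. *)
Definition RP_vspace (p : RP) : {vspace 'cV[R]_d.+1} := line_vspace p.

Lemma RP_vspace_pi (v : nonzero_vec) : RP_vspace (\pi_RP v) = <[nvec v]>%VS.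
Proof. by rewrite unlock. Qed.

Definition GL := {A : 'M[R]_d.+1 | A \in unitmx}.

Definition GL_scaled (A B : GL) : bool :=
  `[< exists2 c : R, c != 0 & val A = c *: val B >].

Lemma GL_scaled_equiv : equiv_class_of GL_scaled.
Proof.
split.
- by move=> A; apply/asboolP; exists 1; rewrite ?oner_neq0 ?scale1r.
- suff s A B : GL_scaled A B -> GL_scaled B A by move=> A B; apply/idP/idP; exact: s.
  move=> /asboolP[c c0 e]; apply/asboolP; exists c^-1; rewrite ?invr_eq0//.
  by rewrite e scalerA mulVf// scale1r.
- move=> B A C /asboolP[a a0 ea] /asboolP[b b0 eb]; apply/asboolP.
  by exists (a * b); rewrite ?mulf_neq0// ea eb scalerA.
Qed.

Canonical GL_scaled_equiv_rel := EquivRelPack GL_scaled_equiv.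

Definition PGL := {eq_quot GL_scaled}.

Definition lmx (A : 'M[R]_d.+1) : 'End('cV[R]_d.+1) := linfun (mulmx A).

Lemma dim_lmx (A : GL) (p : RP) :
  \dim (lmx (val A) @: RP_vspace p)%VS == 1%N.
Proof.
have inj : lker (lmx (val A)) == 0%VS.
  apply/lker0P => u v; rewrite !lfunE/=.
  by move/(congr1 (mulmx (invmx (val A)))); rewrite !mulKmx ?(valP A).
by rewrite limg_dim_eq ?(eqP inj) ?capv0//; exact: line_dim.
Qed.

Definition GL_act (A : GL) (p : RP) : RP := Line (dim_lmx A p).

Definition PGL_act (g : PGL) (p : RP) : RP := GL_act (repr g) p.

Lemma GL_act_scaled (A B : GL) p : GL_scaled A B -> GL_act A p = GL_act B p.
Proof.
move=> /asboolP[c c0 e]; apply: line_inj => /=; rewrite e.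
have -> : lmx (c *: val B) = c *: lmx (val B).
  by apply/lfunP => v; rewrite scale_lfunE !lfunE/= scalemxAl.
apply/vspaceP => v; apply/memv_imgP/memv_imgP => -[u up ->].
  by exists (c *: u); rewrite ?memvZ// scale_lfunE linearZ.
exists (c^-1 *: u); rewrite ?memvZ// scale_lfunE linearZ/=.
by rewrite scalerA mulfV// scale1r.
Qed.

Lemma PGL_act_pi (A : GL) (p : RP) : PGL_act (\pi_PGL A) p = GL_act A p.
Proof.
apply: GL_act_scaled; have /eqmodP := reprK (\pi_PGL A); exact.
Qed.

Variable k : nat.

Definition config : Type := prod_topology (fun _ : 'I_k => RP).
HB.instance Definition _ :=
  Topological.copy config (prod_topology (fun _ : 'I_k => RP)).

Definition config_act (g : PGL) (p : config) : config :=
  fun i => PGL_act g (p i).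

Definition same_orbit (p q : config) : bool :=
  `[< exists g : PGL, q = config_act g p >].

Lemma same_orbitP (p q : config) :
  reflect (exists A : GL, forall i,
             RP_vspace (q i) = (lmx (val A) @: RP_vspace (p i))%VS)
          (same_orbit p q).
Proof.
apply: (iffP (asboolP _)) => [[g ->]|[A h]]; first by exists (repr g).
exists (\pi_PGL A); apply/funext => i; rewrite /config_act PGL_act_pi.
exact: line_inj.
Qed.

Lemma same_orbit_equiv : equiv_class_of same_orbit.
Proof.
have lmxM (A B : 'M[R]_d.+1) U :
    (lmx A @: (lmx B @: U) = lmx (A *m B) @: U)%VS.
  rewrite -limg_comp; congr (_ @: _)%VS.
  by apply/lfunP => v; rewrite comp_lfunE !lfunE/= mulmxA.
have lmx1 U : (lmx 1%:M @: U = U)%VS.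
  rewrite -[RHS]lim1g; congr (_ @: _)%VS.
  by apply/lfunP => v; rewrite id_lfunE lfunE/= mul1mx.
split.
- move=> p; apply/same_orbitP.
  by exists (exist _ 1%:M (unitmx1 _ _)) => i /=; rewrite lmx1.
- suff s p q : same_orbit p q -> same_orbit q p
    by move=> p q; apply/idP/idP; exact: s.
  move=> /same_orbitP[[A uA] /= h]; apply/same_orbitP.
  have uV : invmx A \in unitmx by rewrite unitmx_inv.
  by exists (exist _ (invmx A) uV) => i /=; rewrite h lmxM mulVmx// lmx1.
- move=> q p r /same_orbitP[[A uA] /= hA] /same_orbitP[[B uB] /= hB].
  apply/same_orbitP.
  have uM : B *m A \in unitmx by rewrite unitmx_mul uA uB.
  by exists (exist _ (B *m A) uM) => i /=; rewrite hB hA lmxM.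
Qed.

Canonical same_orbit_equiv_rel := EquivRelPack same_orbit_equiv.

(* The quotient a_d^k of the space of configurations by PGL(d). *)
Definition projective_shape : Type := quotient_topology {eq_quot same_orbit}.
HB.instance Definition _ :=
  Topological.copy projective_shape (quotient_topology {eq_quot same_orbit}).
HB.instance Definition _ :=
  Quotient.copy projective_shape (quotient_topology {eq_quot same_orbit}).

(* A j-dimensional projective subspace is a vector subspace of dimension j + 1;
   it contains the landmark p i iff it contains the line p i. *)
Definition Tyler_regular (p : config) : Prop :=
  forall j : nat, (j < d)%N ->
  forall W : {vspace 'cV[R]_d.+1}, \dim W = j.+1 ->
    #|[pred i : 'I_k | (RP_vspace (p i) <= W)%VS]|%:R
      < k%:R * (j.+1%:R / d.+1%:R) :> R.

Definition Tyler_shapes : set projective_shape :=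
  [set \pi_projective_shape p | p in [set p : config | Tyler_regular p]].

Definition Tyler_space : Type := set_type Tyler_shapes.
HB.instance Definition _ :=
  Topological.copy Tyler_space (set_type Tyler_shapes).

End ProjectiveSpace.

Section Manifold.
Variable R : realType.

(* All iterated partial derivatives of f of order at most m exist and are
   continuous on U; meant for U open. *)
Fixpoint Ck_on (n p : nat) (m : nat) (U : set 'rV[R]_n)
    (f : 'rV[R]_n -> 'rV[R]_p) : Prop :=
  {within U, continuous f} /\
  if m is m'.+1 then
    forall i : 'I_n,
      (forall x, U x -> derivable f x (delta_mx 0 i)) /\
      Ck_on m' U (fun x => 'D_(delta_mx 0 i) f x)
  else True.

Definition smooth_on (n p : nat) (U : set 'rV[R]_n)
    (f : 'rV[R]_n -> 'rV[R]_p) : Prop :=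
  forall m, Ck_on m U f.

(* A homeomorphism between an open subset of M and an open subset of R^n; the
   values of the total functions outside of these sets are irrelevant. *)
Record chart (M : topologicalType) (n : nat) := Chart {
  chart_dom : set M;
  chart_map : M -> 'rV[R]_n;
  chart_inv : 'rV[R]_n -> M;
  chart_dom_open : open chart_dom;
  chart_cod_open : open (chart_map @` chart_dom);
  chart_map_continuous : {within chart_dom, continuous chart_map};
  chart_inv_continuous :
    {within chart_map @` chart_dom, continuous chart_inv};
  chart_mapK : {in chart_dom, cancel chart_map chart_inv} }.

Definition smooth_transition (M : topologicalType) n (c e : chart M n) : Prop :=
  smooth_on (chart_map c @` (chart_dom c `&` chart_dom e))
            (chart_map e \o chart_inv c).

Definition locally_euclidean (M : topologicalType) (n : nat) : Prop :=
  forall x : M, exists c : chart M n, chart_dom c x.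

Definition smooth_atlas (M : topologicalType) n (A : set (chart M n)) : Prop :=
  (forall x : M, exists2 c, A c & chart_dom c x) /\
  (forall c e, A c -> A e -> smooth_transition c e).

Definition differentiable_manifold (M : topologicalType) : Prop :=
  @second_countable M /\
  exists n : nat, locally_euclidean M n /\
    exists A : set (chart M n), smooth_atlas A.

End Manifold.

(* Main.v *)
Require Import Defs.
From mathcomp Require Import all_boot all_order all_algebra.
From mathcomp Require Import all_classical all_reals all_analysis.
From mathcomp Require Import ring lra zify.

(** A configuration is lifted to the matrix of representatives of its landmarks;
    the map from matrices with nonzero columns to shapes is continuous and open.

    Hausdorff: if [N_n = A_n M_n D_n] with [M_n], [N_n] tending to Tyler regular
    [M], [N], normalise [|A_n| = 1] and let [A] be a limit point.  Each column of
    [M] lies in [ker A] or the corresponding column of [N] lies in [im A].  These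
    spaces have complementary dimensions, so if [A] were singular, the Tyler
    bounds would leave fewer than [k] indices.

    Charts: some landmarks form a basis.  In the coordinates of this basis no
    proper set of rows carries all the columns that it meets, again by the Tyler
    bounds for two complementary coordinate subspaces.  Hence the bipartite graph
    of nonzero entries has a spanning tree, and row and column scalings, unique up
    to a common factor, turn the entries along the tree into ones.  The remaining
    entries are the coordinates; transition maps are rational. *)

Set Implicit Arguments.
Unset Strict Implicit.
Unset Printing Implicit Defensive.

Import Order.TTheory GRing.Theory Num.Theory.
Import numFieldNormedType.Exports.

Local Open Scope classical_set_scope.
Local Open Scope ring_scope.
Local Open Scope quotient_scope.

(** * Rational functions are smooth *)

Section RationalFunctions.
Variables (R : realType) (a n : nat).
Implicit Types (U : set 'M[R]_(a, n)) (f g : 'M[R]_(a, n) -> R).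

(** An inductive class lets continuity, derivability and closure under derivatives be proved by one
    induction. The clause [rational_eq] compares values on [U] only, so conventional values
    elsewhere, such as the inverse of 0, do no harm. *)
Inductive rational_on U : ('M[R]_(a, n) -> R) -> Prop :=
| rational_cst c : rational_on U (fun=> c)
| rational_coord i j : rational_on U (fun x => x i j)
| rational_add f g : rational_on U f -> rational_on U g ->
    rational_on U (fun x => f x + g x)
| rational_mul f g : rational_on U f -> rational_on U g ->
    rational_on U (fun x => f x * g x)
| rational_inv f : (forall x, U x -> f x != 0) -> rational_on U f ->
    rational_on U (fun x => (f x)^-1)
| rational_eq f g : (forall x, U x -> f x = g x) -> rational_on U f ->
    rational_on U g.

Lemma rational_opp U f : rational_on U f -> rational_on U (fun x => - f x).
Proof.
move=> rf; apply: (@rational_eq _ (fun x => -1 * f x)) => [x _|].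
  by rewrite mulN1r.
by apply: rational_mul => //; exact: rational_cst.
Qed.

Lemma rational_sum U (I : Type) (r : seq I) (P : pred I)
    (F : I -> 'M[R]_(a, n) -> R) : (forall i, rational_on U (F i)) ->
  rational_on U (fun x => \sum_(i <- r | P i) F i x).
Proof.
move=> rF; elim: r => [|i r IH].
  apply: (@rational_eq _ (fun=> 0)); last exact: rational_cst.
  by move=> x _; rewrite big_nil.
case Pi : (P i).
  apply: (@rational_eq _ (fun x => F i x + \sum_(j <- r | P j) F j x)).
    by move=> x _; rewrite big_cons Pi.
  exact: rational_add.
by apply: rational_eq IH => x _; rewrite big_cons Pi.
Qed.

Lemma rational_prod U (I : Type) (r : seq I) (P : pred I)
    (F : I -> 'M[R]_(a, n) -> R) : (forall i, rational_on U (F i)) ->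
  rational_on U (fun x => \prod_(i <- r | P i) F i x).
Proof.
move=> rF; elim: r => [|i r IH].
  apply: (@rational_eq _ (fun=> 1)); last exact: rational_cst.
  by move=> x _; rewrite big_nil.
case Pi : (P i).
  apply: (@rational_eq _ (fun x => F i x * \prod_(j <- r | P j) F j x)).
    by move=> x _; rewrite big_cons Pi.
  exact: rational_mul.
by apply: rational_eq IH => x _; rewrite big_cons Pi.
Qed.

Lemma rational_det U m (A : 'M[R]_(a, n) -> 'M[R]_m) :
  (forall i j, rational_on U (fun x => A x i j)) ->
  rational_on U (fun x => \det (A x)).
Proof.
move=> rA; apply: rational_sum => s; apply: rational_mul.
  exact: rational_cst.
by apply: rational_prod => i.
Qed.

(** Cramer's rule: on [U] the inverse is the adjugate divided by the nonvanishing determinant. *)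
Lemma rational_invmx U m (A : 'M[R]_(a, n) -> 'M[R]_m) :
  (forall i j, rational_on U (fun x => A x i j)) ->
  (forall x, U x -> A x \in unitmx) ->
  forall i j, rational_on U (fun x => invmx (A x) i j).
Proof.
move=> rA uA i j.
apply: (@rational_eq _ (fun x => (\det (A x))^-1 * cofactor (A x) j i)).
  by move=> x Ux; rewrite /invmx uA// !mxE.
apply: rational_mul.
  apply: rational_inv; last exact: rational_det.
  by move=> x /uA; rewrite unitmxE unitfE.
apply: rational_mul; first exact: rational_cst.
apply: rational_det => i' j'.
by apply: rational_eq (rA (lift j i') (lift i j')) => x _; rewrite !mxE.
Qed.

Lemma rational_mulmx U m p q (A : 'M[R]_(a, n) -> 'M[R]_(m, p))
    (B : 'M[R]_(a, n) -> 'M[R]_(p, q)) :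
  (forall i j, rational_on U (fun x => A x i j)) ->
  (forall i j, rational_on U (fun x => B x i j)) ->
  forall i j, rational_on U (fun x => (A x *m B x) i j).
Proof.
move=> rA rB i j.
apply: (@rational_eq _ (fun x => \sum_k A x i k * B x k j)).
  by move=> x _; rewrite mxE.
by apply: rational_sum => k; exact: rational_mul.
Qed.

(** The three claims are proved together because the product and quotient rules use the derivability
    of the factors. Openness of [U] serves the clause [rational_eq]: functions equal on [U] are
    equal near each of its points, hence have the same derivatives there. *)
Lemma rational_derive U f (v : 'M[R]_(a, n)) : open U -> rational_on U f ->
  [/\ forall x, U x -> {for x, continuous f},
      forall x, U x -> derivable f x v &
      rational_on U (fun x => 'D_v f x)].
Proof.
move=> oU; elim.
- move=> c; split=> [x _|x _|].
  - exact: cst_continuous.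
  - exact: (derivable_cst c x v).
  apply: (@rational_eq _ (fun=> 0)); last exact: rational_cst.
  by move=> x _; rewrite derive_cst.
- move=> i j.
  have di x : derivable (id : 'M[R]_(a, n) -> 'M[R]_(a, n)) x v by exact: derivable_id.
  split=> [x _|x _|]; first exact: coord_continuous.
    exact: (derivable_mxP _ _ _).1 (di x) i j.
  apply: (@rational_eq _ (fun=> v i j)); last exact: rational_cst.
  by move=> x _; have /matrixP/(_ i j) := derive_mx (di x); rewrite derive_id mxE.
- move=> {}f g rf [cf df rDf] rg [cg dg rDg]; split=> [x Ux|x Ux|].
  + exact: (cvgD (cf x Ux) (cg x Ux)).
  + exact: (derivableD (df x Ux) (dg x Ux)).
  + apply: rational_eq (rational_add rDf rDg) => x Ux.
    exact/esym/(deriveD (df x Ux) (dg x Ux)).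
- move=> {}f g rf [cf df rDf] rg [cg dg rDg]; split=> [x Ux|x Ux|].
  + exact: (cvgM (cf x Ux) (cg x Ux)).
  + exact: (derivableM (df x Ux) (dg x Ux)).
  + apply: rational_eq
      (rational_add (rational_mul rf rDg) (rational_mul rg rDf)) => x Ux.
    exact/esym/(deriveM (df x Ux) (dg x Ux)).
- move=> {}f f0 rf [cf df rDf]; split=> [x Ux|x Ux|].
  + exact: (cvgV (f0 x Ux) (cf x Ux)).
  + exact: (derivableV (f0 x Ux) (df x Ux)).
  + apply: rational_eq (rational_opp (rational_mul
      (rational_inv f0 rf) (rational_mul (rational_inv f0 rf) rDf))) => x Ux.
    rewrite (deriveV (f0 x Ux) (df x Ux)).
    by rewrite /GRing.scale/= expr2 invfM mulNr mulrA.
- move=> {}f g fg rf [cf df rDf].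
  have nfg x : U x -> \near x, f x = g x.
    by move=> Ux; move: oU; rewrite openE => /(_ _ Ux); apply: filterS.
  split=> [x Ux|x Ux|].
  + have : f y @[y --> x] --> f x by exact: cf.
    rewrite (fg _ Ux) => + A => /[apply].
    by apply: filterS2 (nfg x Ux) => y /= ->.
  + by apply: near_eq_derivable (df x Ux); exact: nfg.
  + by apply: rational_eq rDf => x Ux; apply: near_eq_derive; exact: nfg.
Qed.

Lemma continuous_mxP (T : topologicalType) m p (f : T -> 'M[R]_(m, p)) x :
  {for x, continuous f} <->
  forall i j, {for x, continuous (fun y => f y i j)}.
Proof.
split=> [cf i j|cf].
  by apply: (@continuous_comp _ _ _ f (fun M => M i j));
    [exact: cf|exact: coord_continuous].
move=> A [P nP PA]; apply: (@filterS _ _ _ (fun y => forall i j, P i j (f y i j))).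
  by move=> y Py; exact: PA.
by apply: filter_forall => i; apply: filter_forall => j; exact: cf.
Qed.

Lemma rational_continuous U f x :
  open U -> rational_on U f -> U x -> {for x, continuous f}.
Proof. by move=> oU rf; have [+ _ _] := rational_derive 0 oU rf; apply. Qed.

Lemma rational_mx_continuous U m p (f : 'M[R]_(a, n) -> 'M[R]_(m, p)) x :
  open U -> (forall i j, rational_on U (fun x => f x i j)) -> U x ->
  {for x, continuous f}.
Proof.
move=> oU rf Ux; apply/continuous_mxP => i j.
exact: rational_continuous (rf i j) Ux.
Qed.

End RationalFunctions.

(** Induction on the order: the partial derivatives are rational on the same open set. *)
Lemma rational_smooth (R : realType) (n p : nat) (U : set 'rV[R]_n)
    (f : 'rV[R]_n -> 'rV[R]_p) : open U ->
  (forall i, rational_on U (fun x => f x 0 i)) -> smooth_on U f.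
Proof.
move=> oU rf m; elim: m f rf => [|m IH] f rf /=.
  split=> //; rewrite continuous_open_subspace// => x /set_mem.
  by apply: rational_mx_continuous => // i j; rewrite ord1.
split.
  rewrite continuous_open_subspace// => x /set_mem.
  by apply: rational_mx_continuous => // i j; rewrite ord1.
move=> i.
have df x : U x -> derivable f x (delta_mx 0 i).
  move=> Ux; apply/derivable_mxP => i' j; rewrite ord1.
  by have [_ + _] := rational_derive (delta_mx 0 i) oU (rf j); exact.
split=> //; apply: IH => j.
have [_ _] := rational_derive (delta_mx 0 i) oU (rf j).
by apply: rational_eq => x Ux; rewrite derive_mx ?mxE//; exact: df.
Qed.

(** * Shapes as classes of matrices *)

Section MatrixLift.
Variables (R : realType) (d k : nat).
Local Notation vec := 'cV[R]_d.+1.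
Local Notation mx := 'M[R]_(d.+1, k).
Local Notation RP := (RP R d).
Local Notation config := (config R d k).
Local Notation shape := (projective_shape R d k).

Lemma const1_neq0 : (const_mx 1 : vec) != 0.
Proof.
apply/eqP => /matrixP/(_ 0 0); rewrite !mxE => /eqP.
by rewrite oner_eq0.
Qed.

(** A total map, so that it can be composed with columns of arbitrary matrices; the zero vector is
    sent to an arbitrary nonzero one. *)
Definition to_nonzero (v : vec) : nonzero_vec R d :=
  insubd (exist (fun u => u \in [set u : vec | u != 0]) (const_mx 1)
            (mem_set const1_neq0) : set_type [set u : vec | u != 0]) v.

Lemma to_nonzeroK (v : vec) : v != 0 -> nvec (to_nonzero v) = v.
Proof.
move=> v0; rewrite /nvec set_valE /to_nonzero.
by rewrite -[LHS]/(val _) val_insubd mem_set.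
Qed.

Lemma nvec_inj : injective (@nvec R d).
Proof. by move=> u v; rewrite /nvec !set_valE; exact: val_inj. Qed.

Lemma nvecK : cancel (@nvec R d) to_nonzero.
Proof. by move=> u; apply: nvec_inj; rewrite to_nonzeroK ?nvec_neq0. Qed.

Definition nonzero_cols : set mx := [set M | forall i, col i M != 0].

Definition config_of (M : mx) : config :=
  fun i => \pi_RP (to_nonzero (col i M)).

Definition shape_of (M : mx) : shape := \pi_shape (config_of M).

Definition lift_config (p : config) : mx := \matrix_(r, c) nvec (repr (p c)) r 0.

Lemma col_lift_config p i : col i (lift_config p) = nvec (repr (p i)).
Proof. by apply/colP => r; rewrite !mxE. Qed.

Lemma lift_config_neq0 p : nonzero_cols (lift_config p).
Proof. by move=> i; rewrite col_lift_config nvec_neq0. Qed.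

Lemma lift_configK : cancel lift_config config_of.
Proof.
move=> p; apply/funext => i; rewrite /config_of col_lift_config nvecK.
exact: reprK.
Qed.

Lemma RP_vspace_config_of M i : nonzero_cols M ->
  RP_vspace (config_of M i) = <[col i M]>%VS.
Proof. by move=> nzM; rewrite /config_of RP_vspace_pi to_nonzeroK. Qed.

Lemma vline_eqP (F : fieldType) (V : vectType F) (u v : V) : v != 0 ->
  <[v]>%VS = <[u]>%VS <-> exists2 c, c != 0 & v = c *: u.
Proof.
move=> v0; split=> [e|[c c0 ->]].
  have /vlineP[c ec] : v \in <[u]>%VS by rewrite -e memv_line.
  by exists c => //; apply: contraNneq v0 => c0; rewrite ec c0 scale0r.
apply/eqP; rewrite eqEsubv -!memvE; apply/andP; split.
  by apply/vlineP; exists c.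
by apply/vlineP; exists c^-1; rewrite scalerA mulVf// scale1r.
Qed.

Lemma pi_RP_eqP (u v : nonzero_vec R d) :
  \pi_RP u = \pi_RP v <-> exists2 c, c != 0 & nvec u = c *: nvec v.
Proof.
rewrite -vline_eqP ?nvec_neq0// -!RP_vspace_pi.
by split=> [->//|e]; exact: line_inj.
Qed.

Lemma lmx_vline (A : 'M[R]_d.+1) (v : vec) :
  (lmx A @: <[v]> = <[A *m v]>)%VS.
Proof. by rewrite limg_line lfunE. Qed.

(** The left factor is the action of PGL(d); the factor of each column is the freedom in choosing a
    representative of its landmark. *)
Lemma shape_of_eqP M N : nonzero_cols M -> nonzero_cols N ->
  shape_of M = shape_of N <->
  exists2 A : 'M[R]_d.+1, A \in unitmx &
    forall i, exists2 c, c != 0 & col i N = c *: (A *m col i M).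
Proof.
move=> nzM nzN; split.
  move=> /eqmodP/same_orbitP[A hA]; exists (val A); first exact: (valP A).
  move=> i; apply/(vline_eqP _ (nzN i)).
  by have := hA i; rewrite !RP_vspace_config_of// lmx_vline.
move=> [A uA hA]; apply/eqmodP/same_orbitP; exists (exist _ A uA) => i /=.
by rewrite !RP_vspace_config_of// lmx_vline; apply/(vline_eqP _ (nzN i)).
Qed.

Lemma near_neq0 (v : vec) : v != 0 -> \forall u \near v, u != 0.
Proof. exact: (@cvgr_neq0 _ _ _ (nbhs v) _ id v cvg_id). Qed.

Lemma to_nonzero_continuous (v : vec) :
  v != 0 -> {for v, continuous to_nonzero}.
Proof.
move=> v0 A [_ [[W oW <-] Wv WA]].
have nW : nbhs v W.
  by apply: open_nbhs_nbhs; split=> //; move: Wv; rewrite /= -/(nvec _) to_nonzeroK.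
apply: filterS2 nW (near_neq0 v0) => u Wu u0; apply: WA => /=.
by rewrite -/(nvec _) to_nonzeroK.
Qed.

Lemma nvec_continuous : continuous (@nvec R d).
Proof. exact: initial_continuous. Qed.

Lemma pi_RP_open (B : set (nonzero_vec R d)) : open B ->
  open [set \pi_RP u | u in B].
Proof.
move=> [W oW <-].
(* The saturation of an open set of vectors is the union of its nonzero multiples. *)
exists (\bigcup_(c in [set c : R | c != 0]) [set v : vec | W (c *: v)]).
  apply: bigcup_open => c _.
  by apply: open_comp oW => v _; exact: scaler_continuous.
apply/seteqP; split => u /=.
  move=> [c c0 Wcu].
  have cu0 : c *: nvec u != 0 by rewrite scaler_eq0 negb_or c0 nvec_neq0.
  exists (to_nonzero (c *: nvec u)).
    by rewrite /= -/(nvec _) to_nonzeroK.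
  by apply/pi_RP_eqP; exists c => //; rewrite to_nonzeroK.
move=> [w Ww] /pi_RP_eqP[c c0 e]; exists c => //.
by rewrite /= -/(nvec _) -e.
Qed.

Lemma config_nbhs (p : config) (U : 'I_k -> set RP) :
  (forall i, nbhs (p i) (U i)) -> nbhs p [set q : config | forall i, U i (q i)].
Proof.
move=> nU; apply: (@filter_forall _ _ (fun i (q : config) => U i (q i)) _
  (nbhs_filter p)) => i.
exact: (@proj_continuous _ (fun=> RP) i p _ (nU i)).
Qed.

Lemma col_continuous i : continuous (fun N : mx => col i N).
Proof.
move=> M; apply/continuous_mxP => r c.
have -> : (fun N : mx => col i N r c) = (fun N : mx => N r i).
  by apply/funext => N; rewrite mxE.
exact: coord_continuous.
Qed.

Lemma config_of_continuous M : nonzero_cols M ->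
  {for M, continuous config_of}.
Proof.
move=> nzM.
have FF : Filter (config_of @ M) := fmap_filter _ (nbhs_filter M).
apply/(@cvg_sup _ _ _ _ (config_of M) FF) => i A [_ [[W oW <-] WM WA]].
have : nbhs M (fun N => W (\pi_RP (to_nonzero (col i N)))).
  have cpi : continuous (\pi_RP : nonzero_vec R d -> RP) by exact: pi_continuous.
  have c2 := continuous_comp (to_nonzero_continuous (nzM i)) (cpi _).
  have c3 := continuous_comp (@col_continuous i M) c2.
  by apply: c3; exact: open_nbhs_nbhs.
by apply: filterS => N WN; exact: WA.
Qed.

Lemma shape_of_continuous M : nonzero_cols M -> {for M, continuous shape_of}.
Proof.
move=> nzM.
have cpi : continuous (\pi_shape : config -> shape) by exact: pi_continuous.
exact: continuous_comp (config_of_continuous nzM) (cpi _).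
Qed.

Lemma open_nonzero_cols : open nonzero_cols.
Proof.
rewrite openE => M nzM.
apply: (@filter_forall _ _ (fun i (N : mx) => col i N != 0) _ (nbhs_filter M)) => i.
exact: (@col_continuous i M _ (near_neq0 (nzM i))).
Qed.

(** Around a matrix of [O] lies a box of entries inside [O]. Each landmark close to that of the
    matrix has a representative in its column of the box, and these representatives form a matrix of
    [O]. *)
Lemma config_of_open (O : set mx) : O `<=` nonzero_cols -> open O ->
  open (config_of @` O).
Proof.
move=> Onz oO; rewrite openE => _ [M OM <-].
have nzM := Onz M OM.
have [P nP PO] : nbhs M O by apply: open_nbhs_nbhs.
pose B c := [set u : nonzero_vec R d | forall r, P r c (nvec u r 0)].
have nB c : nbhs (to_nonzero (col c M)) (B c).
  apply: (@filter_forall _ _ (fun r u => P r c (nvec u r 0)) _ (nbhs_filter _)).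
  move=> r.
  have c1 := @coord_continuous R d.+1 1 r 0 (nvec (to_nonzero (col c M))).
  apply: (continuous_comp (@nvec_continuous (to_nonzero (col c M))) c1).
  by rewrite /= to_nonzeroK// mxE.
have nU c : nbhs (config_of M c) [set \pi_RP u | u in B c].
  move: (nB c); rewrite nbhsE => -[B' [oB' B'M] B'B].
  apply: (@filterS _ _ _ [set \pi_RP u | u in B']).
    by move=> _ [u B'u <-]; exists u => //; exact: B'B.
  apply: open_nbhs_nbhs; split; first exact: pi_RP_open.
  by exists (to_nonzero (col c M)).
apply: filterS (config_nbhs nU) => q Uq.
pose u c := sval (cid2 (Uq c)).
have Bu c : B c (u c) by rewrite /u; case: cid2.
have pu c : \pi_RP (u c) = q c by rewrite /u; case: cid2.
exists (\matrix_(r, c) nvec (u c) r 0).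
  by apply: PO => r c; rewrite mxE; exact: Bu.
apply/funext => c; rewrite -pu /config_of; congr \pi_RP.
rewrite -[RHS]nvecK; congr to_nonzero.
by apply/colP => r; rewrite !mxE.
Qed.

(** The preimage in the space of configurations is the image of the saturation [S] of [O] under
    invertible left factors and nonzero column factors; [S] is a union of preimages of [O] under
    continuous maps. *)
Lemma shape_of_open (O : set mx) : O `<=` nonzero_cols -> open O ->
  open (shape_of @` O).
Proof.
move=> Onz oO.
pose act (Ac : 'M[R]_d.+1 * 'rV[R]_k) (N : mx) := Ac.1 *m N *m diag_mx Ac.2.
have colact Ac N i : col i (act Ac N) = Ac.2 0 i *: (Ac.1 *m col i N).
  apply/colP => r; rewrite !mxE (bigD1 i)//= big1 => [|j ji].
    rewrite !mxE eqxx mulr1n addr0 mulrC; congr (_ * _).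
    by apply: eq_bigr => s _; rewrite !mxE.
  by rewrite !mxE (negPf ji) mulr0n mulr0.
pose good := [set Ac : 'M[R]_d.+1 * 'rV[R]_k |
  Ac.1 \in unitmx /\ forall i, Ac.2 0 i != 0].
pose S := nonzero_cols `&` \bigcup_(Ac in good) (act Ac @^-1` O).
have oS : open S.
  apply: openI; first exact: open_nonzero_cols.
  apply: bigcup_open => Ac _; apply: open_comp oO => N _.
  apply: (@rational_mx_continuous R _ _ setT) => //; first exact: openT.
  apply: rational_mulmx; last by move=> *; exact: rational_cst.
  by apply: rational_mulmx => *; [exact: rational_cst|exact: rational_coord].
rewrite (_ : open _ = open (\pi_shape @^-1` (shape_of @` O)))//.
rewrite (_ : _ @^-1` _ = config_of @` S).
  by apply: config_of_open => // N [].
apply/seteqP; split => p /=.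
  rewrite -(lift_configK p); set N := lift_config p.
  have nzN : nonzero_cols N by exact: lift_config_neq0.
  move=> [M OM] /esym/(shape_of_eqP nzN (Onz _ OM))[A uA hA].
  pose c := \row_i sval (cid2 (hA i)).
  have [c0 hc] : (forall i, c 0 i != 0) /\
      forall i, col i M = c 0 i *: (A *m col i N).
    by split=> i; rewrite mxE; case: (cid2 (hA i)).
  exists N => //; split=> //; exists (A, c) => //=.
  rewrite (_ : act _ _ = M)//; apply/matrixP => r i.
  by have /colP/(_ r) := colact (A, c) N i; rewrite -hc !mxE.
move=> [N [nzN [[A c] [uA c0] ON]] <-]; exists (act (A, c) N) => //.
apply/esym/shape_of_eqP => //; first exact: Onz.
by exists A => // i; exists (c 0 i); rewrite // colact.
Qed.

End MatrixLift.
Arguments nonzero_cols {R d k}.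
Arguments shape_of {R d k}.

(** * Tyler regular matrices *)

(** Vectors outside the current subspace are adjoined one at a time. *)
Lemma subspace_extend (F : fieldType) (V : vectType F) (U : {vspace V}) m :
  (\dim U <= m <= \dim {:V})%N ->
  exists2 W : {vspace V}, (U <= W)%VS & \dim W = m.
Proof.
move=> /andP[Um mV]; elim: m Um mV => [|m IH] Um mV.
  by exists U => //; apply/eqP; rewrite -leqn0.
have [Um'|mU] := leqP (\dim U) m; last by exists U => //; lia.
have [W UW Wm] := IH Um' (ltnW mV).
have /subvPn[v _ vW] : ~~ (fullv <= W)%VS.
  by apply: contraL mV => /dimvS; rewrite Wm -ltnNge ltnS.
exists (W + <[v]>)%VS; first exact: subv_trans UW (addvSl _ _).
rewrite dimv_disjoint_sum ?Wm ?dim_vline.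
  by rewrite (_ : v != 0) ?addn1//; apply: contraNneq vW => ->; rewrite mem0v.
apply/eqP; rewrite -subv0; apply/subvP => u; rewrite memv_cap memv0.
move=> /andP[uW /vlineP[c uv]]; move: uW; rewrite uv.
have [->|c0 cvW] := eqVneq c 0; first by rewrite scale0r.
by case/negP: vW; rewrite -[v](scalerK c0) memvZ.
Qed.

(** * Rank of a selection of columns *)

Section MaskedRank.
Variables (R : realType) (m k : nat).
Local Notation mx := 'M[R]_(m, k).

(** Columns outside [C] are zeroed rather than deleted, so that the matrix size does not depend on
    [C]. The rank is the dimension of the span of the columns in [C]. *)
Definition mask_cols (C : {set 'I_k}) (M : mx) : mx :=
  \matrix_(r, c) if c \in C then M r c else 0.

Lemma rank_mask_le (C : {set 'I_k}) (M : mx) (W : {vspace 'cV[R]_m}) :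
  (forall i, i \in C -> col i M \in W) -> (\rank (mask_cols C M) <= \dim W)%N.
Proof.
move=> CW.
pose B := \matrix_(r < m, j < \dim W) (vbasis W)`_j r 0.
pose X := \matrix_(j < \dim W, i < k)
  if i \in C then coord (vbasis W) j (col i M) else 0.
suff -> : mask_cols C M = B *m X by exact: mulmx_max_rank.
apply/matrixP => r i; rewrite !mxE; case: ifPn => iC; last first.
  by rewrite big1// => j _; rewrite !mxE (negPf iC) mulr0.
have /(congr1 (fun v : 'cV_m => v r 0)) := coord_vbasis (CW i iC).
rewrite mxE => ->; rewrite summxE; apply: eq_bigr => j _.
by rewrite !mxE iC mulrC.
Qed.

Lemma rank_mask_subspace (C : {set 'I_k}) (M : mx) n :
  (\rank (mask_cols C M) <= n <= m)%N ->
  exists2 W : {vspace 'cV[R]_m}, \dim W = n & forall i, i \in C -> col i M \in W.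
Proof.
move=> /andP[rn nm].
set A := mask_cols C M in rn *.
pose U : {vspace 'cV[R]_m} := span [seq col j (col_base A) | j : 'I_(\rank A)].
have [|W UW dW] := @subspace_extend _ _ U n.
  apply/andP; split; last by rewrite dimvf /dim/= muln1.
  by rewrite (leq_trans (dim_span _))// size_map size_enum_ord.
exists W => // i iC; apply: (subvP UW).
have -> : col i M = \sum_j row_base A j i *: col j (col_base A).
  apply/colP => r; rewrite summxE mxE.
  have /matrixP/(_ r i) := mulmx_base A; rewrite [RHS]mxE iC => <-.
  by rewrite mxE; apply: eq_bigr => j _; rewrite !mxE mulrC.
apply: rpred_sum => j _; apply/rpredZ/memv_span.
by apply/mapP; exists j => //; rewrite mem_enum.
Qed.

(** Lower semicontinuity of the rank: a compression of the masked matrix to size [r] with nonzero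
    determinant at [M] keeps a nonzero determinant nearby. *)
Lemma near_rank_mask (C : {set 'I_k}) (M : mx) :
  \forall N \near M, (\rank (mask_cols C M) <= \rank (mask_cols C N))%N.
Proof.
set A := mask_cols C M; set r := \rank A.
(* [L] and [K] come from the rank factorisation of [A] and compress it to the identity. *)
pose L : 'M[R]_(r, m) := pid_mx r *m invmx (col_ebase A).
pose K : 'M[R]_(k, r) := invmx (row_ebase A) *m pid_mx r.
have LAK : L *m A *m K = 1%:M.
  rewrite -{1}(mulmx_ebase A) /L /K !mulmxA mulmxKV ?col_ebase_unit//.
  rewrite mulmxK ?row_ebase_unit// !pid_mx_id ?rank_leq_row ?rank_leq_col//.
  by rewrite pid_mx_1.
pose f (N : mx) := \det (L *m mask_cols C N *m K).
have rf : rational_on setT f.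
  apply: rational_det; apply: rational_mulmx; last by move=> *; exact: rational_cst.
  apply: rational_mulmx => [*|i j]; first exact: rational_cst.
  have [jC|jC] := boolP (j \in C).
    by apply: rational_eq (rational_coord _ i j) => N _; rewrite mxE jC.
  by apply: rational_eq (rational_cst _ 0) => N _; rewrite mxE (negPf jC).
have fM : f M != 0 by rewrite /f LAK det1 oner_neq0.
have cf := rational_continuous openT rf (I : setT M).
apply: filterS (cvgr_neq0 _ cf fM) => N fN.
have u : L *m mask_cols C N *m K \in unitmx by rewrite unitmxE unitfE.
by rewrite -(mxrank_unit u) (leq_trans (mxrankM_maxl _ _))// mxrankM_maxr.
Qed.

End MaskedRank.

(** * The Tyler condition on matrices *)

Section Tyler.
Variables (R : realType) (d k : nat).
Local Notation vec := 'cV[R]_d.+1.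
Local Notation mx := 'M[R]_(d.+1, k).
Local Notation shape := (projective_shape R d k).

Definition Tyler_mx (M : mx) : Prop :=
  forall j, (j < d)%N -> forall W : {vspace vec}, \dim W = j.+1 ->
  (#|[pred i | col i M \in W]| * d.+1 < k * j.+1)%N.

Lemma Tyler_config_of (M : mx) : nonzero_cols M ->
  Tyler_regular (config_of M) <-> Tyler_mx M.
Proof.
move=> nzM.
have e (W : {vspace vec}) j :
    (#|[pred i | (RP_vspace (config_of M i) <= W)%VS]|%:R
      < k%:R * (j.+1%:R / d.+1%:R) :> R) =
    (#|[pred i | col i M \in W]| * d.+1 < k * j.+1)%N.
  rewrite mulrA ltr_pdivlMr ?ltr0n// -!natrM ltr_nat.
  by congr (_ * _ < _)%N; apply: eq_card => i; rewrite !inE RP_vspace_config_of.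
by split=> T j jd W dW; [rewrite -e|rewrite e]; apply: T.
Qed.

(** The landmarks of [q] in [W] are those of [p] in the inverse image of [W], which has the same
    dimension. *)
Lemma Tyler_regular_orbit (p q : config R d k) :
  same_orbit p q -> Tyler_regular p -> Tyler_regular q.
Proof.
move=> /same_orbitP[A hA] T j jd W dW.
have uA := valP A.
pose W' : {vspace vec} := (lmx (invmx (val A)) @: W)%VS.
have lK (U : {vspace vec}) : (lmx (invmx (val A)) @: (lmx (val A) @: U) = U)%VS.
  rewrite -limg_comp -[RHS]lim1g; congr (_ @: _)%VS.
  by apply/lfunP => v; rewrite comp_lfunE id_lfunE !lfunE/= mulKmx.
have lKV (U : {vspace vec}) : (lmx (val A) @: (lmx (invmx (val A)) @: U) = U)%VS.
  rewrite -limg_comp -[RHS]lim1g; congr (_ @: _)%VS.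
  by apply/lfunP => v; rewrite comp_lfunE id_lfunE !lfunE/= mulKVmx.
have dW' : \dim W' = j.+1.
  rewrite -dW limg_dim_eq//; apply/eqP; rewrite -subv0; apply/subvP => u.
  rewrite memv_cap memv0 memv_ker lfunE/= => /andP[_ /eqP u0].
  by rewrite -[u](mulKVmx uA) u0 mulmx0.
rewrite (eq_card (B := [pred i | (RP_vspace (p i) <= W')%VS])).
  exact: T.
move=> i; rewrite !inE hA; apply/idP/idP => s.
  by rewrite -(lK (RP_vspace (p i))); exact: limgS.
by rewrite -(lKV W); exact: limgS.
Qed.

Lemma Tyler_shape_of (M : mx) : nonzero_cols M ->
  Tyler_shapes (shape_of M) <-> Tyler_mx M.
Proof.
move=> nzM; rewrite -Tyler_config_of//; split=> [[p Tp]|T].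
  by move=> /eqmodP/Tyler_regular_orbit; exact.
by exists (config_of M).
Qed.

Definition Tyler_lifts : set mx := nonzero_cols `&` [set M | Tyler_mx M].

(** Near [M] no set of columns loses rank. So if the columns of [N] with indices in [C] lie in [W],
    those of [M] fit into some [W'] of the same dimension, and the bound for [M] and [W'] passes to
    [N] and [W]. *)
Lemma open_Tyler_lifts : open Tyler_lifts.
Proof.
apply: openI; first exact: open_nonzero_cols.
rewrite openE => M TM.
have : \forall N \near M, forall C : {set 'I_k},
    (\rank (mask_cols C M) <= \rank (mask_cols C N))%N.
  apply: (@filter_forall _ _ (fun C N =>
    (\rank (mask_cols C M) <= \rank (mask_cols C N))%N) _ (nbhs_filter M)) => C.
  exact: near_rank_mask.
apply: filterS => N MN j jd W dW.
pose C := [set i | col i N \in W]%SET.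
have CW i : i \in C -> col i N \in W by rewrite inE.
have := leq_trans (MN C) (rank_mask_le CW); rewrite dW => rj.
have [|W' dW' CW'] := @rank_mask_subspace _ _ _ C M j.+1; first by rewrite rj/=; lia.
apply: leq_ltn_trans (TM j jd W' dW'); rewrite leq_mul2r; apply/orP; right.
apply/subset_leq_card/fintype.subsetP => i; rewrite inE => iW.
by apply: CW'; rewrite inE.
Qed.

(* In complementary dimensions the two Tyler bounds add up to less than [k]. *)
Lemma Tyler_complement (M N : mx) (U W : {vspace vec}) :
  Tyler_mx M -> Tyler_mx N -> (0 < \dim U < d.+1)%N ->
  (\dim U + \dim W)%N = d.+1 ->
  exists i, col i M \notin U /\ col i N \notin W.
Proof.
move=> TM TN /andP[U0 Ud] UW; apply: contrapT => no.
have [W0 Wd] : (0 < \dim W)%N /\ (\dim W < d.+1)%N by lia.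
have bU := TM (\dim U).-1 _ U; have bW := TN (\dim W).-1 _ W.
rewrite !prednK// in bU bW.
have {}bU := bU ltac:(lia) erefl; have {}bW := bW ltac:(lia) erefl.
set a := #|_| in bU; set b := #|_| in bW.
suff : (k <= a + b)%N by nia.
rewrite -[k]card_ord -cardUI; apply: leq_trans (leq_addr _ _).
apply/subset_leq_card/fintype.subsetP => i _; rewrite !inE; apply/negPn/negP.
by rewrite negb_or => /andP[iU iW]; apply: no; exists i.
Qed.


(** Proportionality as vanishing of the 2 x 2 minors: a closed polynomial condition, which also
    admits zero vectors and hence survives limits. *)
Definition parallel (u v : vec) := forall r s, u r 0 * v s 0 = u s 0 * v r 0.

Lemma parallelZ c (v : vec) : parallel v (c *: v).
Proof. by move=> r s; rewrite !mxE; ring. Qed.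

Lemma parallelP (u v : vec) : u != 0 -> v != 0 -> parallel u v ->
  exists2 c, c != 0 & v = c *: u.
Proof.
move=> /cV0Pn[s us] v0 uv.
have e : v = (v s 0 / u s 0) *: u.
  apply/colP => r; rewrite mxE mulrAC [v s 0 * _]mulrC uv.
  by rewrite mulrAC mulfV// mul1r.
by exists (v s 0 / u s 0) => //; apply: contraNneq v0 => c0; rewrite e c0 scale0r.
Qed.

(* A nonzero limit [A] of rescaled transformations taking [M'] to [N'] is
   invertible, as otherwise each column of [M] is in the kernel of [A] or the
   corresponding column of [N] in its image. *)
Lemma limit_transformation_unit (A : 'M[R]_d.+1) (M N : mx) :
  nonzero_cols M -> nonzero_cols N -> Tyler_mx M -> Tyler_mx N -> A != 0 ->
  (forall i, parallel (A *m col i M) (col i N)) -> A \in unitmx.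
Proof.
move=> nzM nzN TM TN A0 AMN.
have dT : (\dim (lker (lmx A)) + \dim (limg (lmx A)) = d.+1)%N.
  by rewrite -{1}(capfv (lker _)) limg_ker_dim dimvf /dim/= muln1.
have [K0|K0] := posnP (\dim (lker (lmx A))).
  rewrite -unitmx_tr -row_free_unit -kermx_eq0 -submx0.
  apply/rV_subP => u /sub_kermxP uA; rewrite submx0 -trmx_eq0.
  have : u^T \in lker (lmx A).
    by rewrite memv_ker lfunE/= -[A]trmxK -trmx_mul uA trmx0.
  by move/eqP: K0; rewrite dimv_eq0 => /eqP ->; rewrite memv0.
have Kd : (\dim (lker (lmx A)) < d.+1)%N.
  suff : (0 < \dim (limg (lmx A)))%N by lia.
  rewrite lt0n dimv_eq0; apply: contra A0 => /eqP A0; apply/eqP/matrixP => r s.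
  have : A *m delta_mx s 0 \in limg (lmx A).
    by rewrite -[A *m _](lfunE (mulmx A)); apply: memv_img; rewrite memvf.
  rewrite A0 memv0 -colE => /eqP/colP/(_ r).
  by rewrite !mxE.
have [|i [iK iL]] := Tyler_complement TM TN _ dT; first by rewrite K0.
case/negP: iL; move: iK; rewrite memv_ker lfunE/= => Ai.
have [c c0 ->] := parallelP Ai (nzN i) (AMN i).
by rewrite rpredZ// -[A *m _](lfunE (mulmx A)); apply: memv_img; rewrite memvf.
Qed.

End Tyler.

(** * Hausdorff separation and second countability *)

Section TylerTopology.
Variables (R : realType) (d k : nat).
Local Notation vec := 'cV[R]_d.+1.
Local Notation mx := 'M[R]_(d.+1, k).
Local Notation shape := (projective_shape R d k).
Local Notation Tyler := (Tyler_space R d k).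

Definition shape_val (t : Tyler) : shape := set_val t.

Lemma shape_val_inj : injective shape_val.
Proof. by move=> s t; rewrite /shape_val !set_valE; exact: val_inj. Qed.

Lemma shape_val_continuous : continuous shape_val.
Proof. exact: initial_continuous. Qed.

Definition lift_shape (s : shape) : mx := lift_config (repr s).

Lemma lift_shapeK s : shape_of (lift_shape s) = s.
Proof. by rewrite /shape_of lift_configK reprK. Qed.

Lemma lift_shape_neq0 s : nonzero_cols (lift_shape s).
Proof. exact: lift_config_neq0. Qed.

Lemma lift_shape_Tyler (t : Tyler) : Tyler_lifts (lift_shape (shape_val t)).
Proof.
split; first exact: lift_shape_neq0.
apply/Tyler_shape_of; first exact: lift_shape_neq0.
by rewrite lift_shapeK /shape_val set_valE; apply: set_mem; exact: (valP t).
Qed.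

Lemma Tyler_space_ex (M : mx) : Tyler_lifts M ->
  exists t : Tyler, shape_val t = shape_of M.
Proof.
move=> [nzM /(Tyler_shape_of nzM) TM].
by exists (exist _ (shape_of M) (mem_set TM)); rewrite /shape_val set_valE.
Qed.

(** The sphere is taken among row vectors, where closed bounded sets are compact, and carried over
    by [vec_mx]. *)
Lemma unit_sphere_compact m n : exists2 S : set 'M[R]_(m, n),
  compact S & (forall A, S A -> A != 0) /\
    (forall A, A != 0 -> exists2 c, c != 0 & S (c *: A)).
Proof.
pose K := [set v : 'rV[R]_(m * n) | `|v| = 1].
have cK : compact K.
  apply: bounded_closed_compact.
    by exists 1; split; rewrite ?num_real// => x x1 v /= ->; exact: ltW.
  rewrite (_ : K = Num.norm @^-1` [set 1 : R])//.
  apply: closed_comp; last exact: closed_eq.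
  by move=> v _; exact: norm_continuous.
exists (vec_mx @` K).
  apply: continuous_compact => //; apply: continuous_subspaceT => v.
  apply/continuous_mxP => i j.
  have -> : (fun y : 'rV[R]_(m * n) => (vec_mx y : 'M[R]_(m, n)) i j) = 
    (fun y : 'rV[R]_(m * n) => y 0 (mxvec_index i j)).
    by apply/funext => y; rewrite mxE.
  exact: coord_continuous.
split=> [_ [v v1 <-]|A A0].
  apply/eqP => /(congr1 mxvec); rewrite vec_mxK linear0 => v0.
  by move: v1; rewrite /K/= v0 normr0 => /eqP; rewrite eq_sym oner_eq0.
have nA : `|mxvec A| != 0 by rewrite normr_eq0 mxvec_eq0.
exists `|mxvec A|^-1; first by rewrite invr_eq0.
exists (`|mxvec A|^-1 *: mxvec A); last by rewrite linearZ/= mxvecK.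
by rewrite /K/= normrZ normfV normr_id mulVf.
Qed.

(** Some 2 x 2 minor is nonzero, and it depends continuously on all three matrices. *)
Lemma near_not_parallel (A : 'M[R]_d.+1) (M N : mx) i :
  ~ parallel (A *m col i M) (col i N) ->
  \forall A' \near A & MN \near (M, N),
    ~ parallel (A' *m col i MN.1) (col i MN.2).
Proof.
move=> /existsNP[r /existsNP[s ne]].
pose T := ('M[R]_d.+1 * (mx * mx))%type.
pose F : set_system T := filter_prod (nbhs A) (filter_prod (nbhs M) (nbhs N)).
have FF : Filter F by exact: filter_prod_filter.
have c1 : (fun x : T => x.1) @ F --> A by exact: cvg_fst.
have c2 : (fun x : T => x.2) @ F --> filter_prod (nbhs M) (nbhs N).
  exact: cvg_snd.
have c21 : (fun x : T => x.2.1) @ F --> M.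
  exact: (cvg_comp _ _ c2 cvg_fst).
have c22 : (fun x : T => x.2.2) @ F --> N.
  exact: (cvg_comp _ _ c2 cvg_snd).
have cA q j : (fun x : T => x.1 q j) @ F --> A q j.
  exact: (cvg_comp _ _ c1 (@coord_continuous _ _ _ q j A)).
have cM q j : (fun x : T => x.2.1 q j) @ F --> M q j.
  exact: (cvg_comp _ _ c21 (@coord_continuous _ _ _ q j M)).
have cN q j : (fun x : T => x.2.2 q j) @ F --> N q j.
  exact: (cvg_comp _ _ c22 (@coord_continuous _ _ _ q j N)).
have cAM q : (fun x : T => \sum_j x.1 q j * x.2.1 j i) @ F -->
    \sum_j A q j * M j i.
  by apply: cvg_big => [|j _]; [exact: add_continuous|exact: cvgM].
pose g (x : T) := (\sum_j x.1 r j * x.2.1 j i) * x.2.2 s i -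
  (\sum_j x.1 s j * x.2.1 j i) * x.2.2 r i.
have minor (B : 'M[R]_d.+1) (K L : mx) p q :
    (B *m col i K) p 0 * (col i L) q 0 = (\sum_j B p j * K j i) * L q i.
  by rewrite !mxE; congr (_ * _); apply: eq_bigr => j _; rewrite mxE.
have cg : g @ F --> g (A, (M, N)).
  exact: (cvgB (cvgM (cAM r) (cN s i)) (cvgM (cAM s) (cN r i))).
have g0 : g (A, (M, N)) != 0.
  by rewrite subr_eq0; apply/eqP; move: ne; rewrite !minor.
apply: filterS (cvgr_neq0 _ cg g0) => -[A' [M' N']] /= g' /(_ r s).
by rewrite !minor => /eqP; rewrite -subr_eq0; exact/negP.
Qed.

Lemma Tyler_space_hausdorff : hausdorff_space Tyler.
Proof.
move=> p q clpq; apply: shape_val_inj.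
set M := lift_shape (shape_val p); set N := lift_shape (shape_val q).
have [nzM TM] : Tyler_lifts M := lift_shape_Tyler p.
have [nzN TN] : Tyler_lifts N := lift_shape_Tyler q.
have [S cS [S0 Sscale]] := unit_sphere_compact d.+1 d.+1.
(* This is the limit transformation. If there were none, compactness of [S] would give one
   neighbourhood of [(M, N)] excluding all of [S] at once, although [p] and [q] cannot be
   separated. *)
have [A [SA AMN]] : exists A, S A /\ forall i, parallel (A *m col i M) (col i N).
  apply: contrapT => no.
  have : \forall MN \near (M, N), forall A, S A ->
      ~ forall i, parallel (A *m col i MN.1) (col i MN.2).
    have cov := (compact_near_coveringP S).1 cS.
    apply: (cov _ (nbhs (M, N)) (fun (MN : mx * mx) A =>
      ~ forall i, parallel (A *m col i MN.1) (col i MN.2)) (nbhs_filter _)).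
    move=> A SA; have : ~ forall i, parallel (A *m col i M) (col i N).
      by move=> h; apply: no; exists A.
    move=> /existsNP[i /near_not_parallel].
    by apply: filterS => -[A' MN] h h'; apply: h; exact: h'.
  move=> [[P Q] /= [nP nQ] PQ].
  (* As [shape_of] is open, shapes near [t] have lifts near any given lift [L] of [t]. *)
  have nbh (t : Tyler) L U : shape_val t = shape_of L -> nonzero_cols L ->
      nbhs L U -> nbhs t [set t' | exists2 L', U L' /\ nonzero_cols L' &
        shape_val t' = shape_of L'].
    move=> tL nzL; rewrite nbhsE => -[U' [oU' U'L] U'U].
    have oO : open (shape_of @` (U' `&` @nonzero_cols R d k)).
      apply: shape_of_open; first by move=> ? [].
      by apply: openI => //; exact: open_nonzero_cols.
    have : nbhs t (shape_val @^-1` (shape_of @` (U' `&` @nonzero_cols R d k))).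
      apply: shape_val_continuous; apply: open_nbhs_nbhs; split=> //.
      by rewrite tL; exists L.
    apply: filterS => t' [L' [/U'U UL' nzL'] e].
    by exists L'.
  have [t [[M' [PM' nzM'] tM'] [N' [QN' nzN'] tN']]] := clpq _ _
    (nbh p M P (esym (lift_shapeK _)) nzM nP)
    (nbh q N Q (esym (lift_shapeK _)) nzN nQ).
  have /(shape_of_eqP nzM' nzN')[A uA hA] : shape_of M' = shape_of N'.
    by rewrite -tM'.
  have A0 : A != 0.
    by apply: contraTneq uA => ->; rewrite unitmxE det0 unitr0.
  have [c c0 ScA] := Sscale _ A0.
  apply: (PQ (M', N') (conj PM' QN') _ ScA) => i /=.
  have [e e0 ->] := hA i.
  (* Normalising [A] by [c] is absorbed by the column factor. *)
  rewrite (_ : e *: _ = (e / c) *: (c *: A *m col i M')); first exact: parallelZ.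
  by rewrite -scalemxAl scalerA divfK.
have uA := limit_transformation_unit nzM nzN TM TN (S0 _ SA) AMN.
rewrite -[LHS]lift_shapeK -[RHS]lift_shapeK; apply/shape_of_eqP => //.
exists A => // i; apply: parallelP (AMN i); last exact: nzN.
apply: contraNneq (nzM i) => A0.
by rewrite -[col i M](mulKmx uA) A0 mulmx0.
Qed.

(** * A countable basis from boxes with rational corners *)

Definition rational_box m n (C D : 'M[rat]_(m, n)) : set 'M[R]_(m, n) :=
  [set M | forall i j, ratr (C i j) < M i j < ratr (D i j)].

Lemma rational_box_open m n (C D : 'M[rat]_(m, n)) : open (rational_box C D).
Proof.
rewrite openE => M CD; exists (fun i j => `]ratr (C i j), ratr (D i j)[%classic).
  move=> i j; apply: open_nbhs_nbhs; split; first exact: interval_open.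
  by rewrite /= in_itv/=; exact: CD.
by move=> N /= h i j; have := h i j; rewrite in_itv.
Qed.

Lemma rational_box_nbhs m n (M : 'M[R]_(m, n)) (U : set 'M[R]_(m, n)) :
  nbhs M U -> exists C D, rational_box C D M /\ rational_box C D `<=` U.
Proof.
move=> [P nP PU].
have ex i j : exists qr : rat * rat, ratr qr.1 < M i j < ratr qr.2 /\
    forall x, ratr qr.1 < x < ratr qr.2 -> P i j x.
  have /nbhs_ballP[e/= e0 eP] := nP i j.
  have [q] := @rat_in_itvoo R (M i j - e) (M i j) ltac:(by rewrite ltrBlDr ltrDl).
  have [r] := @rat_in_itvoo R (M i j) (M i j + e) ltac:(by rewrite ltrDl).
  rewrite !in_itv/= => /andP[Mr re] /andP[eq qM].
  exists (q, r); split; first by rewrite qM.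
  move=> x /andP[qx xr]; apply: eP; rewrite /ball/= ltr_norml.
  by rewrite ltrBlDr ltrBrDr; apply/andP; split; lra.
exists (\matrix_(i, j) (sval (cid (ex i j))).1).
exists (\matrix_(i, j) (sval (cid (ex i j))).2); split.
  by move=> i j; rewrite !mxE; case: (cid (ex i j)) => x [].
move=> N hN; apply: PU => i j; have := hN i j; rewrite !mxE.
by case: (cid (ex i j)) => x /= [_]; apply.
Qed.

(** The rational boxes form a countable basis upstairs, and a continuous open surjection carries a
    basis to a basis. *)
Lemma Tyler_space_second_countable : @second_countable Tyler.
Proof.
pose box (CD : 'M[rat]_(d.+1, k) * 'M[rat]_(d.+1, k)) : set Tyler :=
  shape_val @^-1` (shape_of @` (rational_box CD.1 CD.2 `&` @nonzero_cols R d k)).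
exists (range box).
  by apply: sub_countable (card_image_le _ _) _; exact: countableP.
split.
  move=> _ [CD _ <-]; apply: open_comp; first by move=> t _; exact: shape_val_continuous.
  apply: shape_of_open; first by move=> ? [].
  by apply: openI; [exact: rational_box_open|exact: open_nonzero_cols].
move=> t A [_ [[W oW <-] Wt WA]].
have [nzM TM] := lift_shape_Tyler t; set M := lift_shape _ in nzM TM.
have nM : nbhs M (shape_of @^-1` W).
  apply: (shape_of_continuous nzM); apply: open_nbhs_nbhs; split=> //.
  by rewrite lift_shapeK.
have [C [D [CDM CDW]]] := rational_box_nbhs nM.
exists (box (C, D)).
  split; first by exists (C, D).
  by exists M => //; exact: lift_shapeK.
move=> s [N [/CDW WN nzN] sN]; apply: WA; rewrite /=.
by rewrite -/(shape_val s) -sN.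
Qed.

End TylerTopology.
Arguments shape_val {R d k}.

(** * Normal forms *)

Section Frames.
Variables (d k : nat).

(* A spanning tree of the bipartite graph of rows and columns, rooted at row
   [ord0], in which the basis columns are leaves; [row_height] rules out cycles.
   The parent of the root is irrelevant. *)
Record frame := Frame {
  basis_col : 'I_d.+1 -> 'I_k;
  row_parent : 'I_d.+1 -> 'I_k;
  col_parent : 'I_k -> 'I_d.+1;
  row_height : 'I_d.+1 -> nat;
  basis_colK : cancel basis_col col_parent;
  row_parentNbasis : forall r j, r != ord0 -> row_parent r != basis_col j;
  row_height_lt : forall r, r != ord0 ->
    (row_height (col_parent (row_parent r)) < row_height r)%N }.

Arguments row_parentNbasis f [r] j _.
Arguments row_height_lt f [r] _.

Variable F : frame.
Local Notation fb := (basis_col F).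
Local Notation pr := (row_parent F).
Local Notation pc := (col_parent F).
Local Notation ht := (row_height F).

(** The [one_entry]s are the tree edges: from a column to its parent row, or from a row other than
    the root to its parent column. The [zero_entry]s are the off-diagonal entries of the basis
    columns, [fb (pc c) == c] saying that [c] is such a column. *)
Definition one_entry r c := (pc c == r) || (r != ord0) && (pr r == c).
Definition zero_entry r c := (pc c != r) && (fb (pc c) == c).
Definition free_entry r c := ~~ one_entry r c && ~~ zero_entry r c.

(** All entries minus the [d.+1 * d] zeros and the [d + k] tree edges. This is d(k - d - 2), the
    dimension of the space of configurations minus that of PGL(d). *)
Definition shape_dim := (d.+1 * k - (d.+1 * d + (d + k)))%N.

(** The kinds of entries are disjoint: a row and a column that were each other's parent would make
    [row_height] drop below itself, and a basis column is the parent of no row. *)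
Lemma entry_split r c : (free_entry r c + zero_entry r c +
  (((r != ord0) && (pr r == c)) + (pc c == r)) = 1)%N.
Proof.
rewrite /free_entry /one_entry /zero_entry.
have [pcr|pcr] /= := eqVneq (pc c) r.
  case: (boolP (r != ord0)) => //= r0; case: eqP => // prc.
  by have := row_height_lt F r0; rewrite prc pcr ltnn.
case: (boolP (r != ord0)) => r0 /=; last by case: (fb (pc c) == c).
case: (eqVneq (pr r) c) => [prc|] /=; last by case: (fb (pc c) == c).
case: eqP => // fc.
by have := row_parentNbasis F (pc c) r0; rewrite prc fc eqxx.
Qed.

(** Sum [entry_split] over all entries: each row but the root and each column contributes one edge,
    each of the [d.+1] basis columns [d] zeros. *)
Lemma card_free_entry :
  #|[pred rc : 'I_d.+1 * 'I_k | free_entry rc.1 rc.2]| = shape_dim.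
Proof.
have sumE (P : 'I_d.+1 -> 'I_k -> bool) :
    #|[pred rc : 'I_d.+1 * 'I_k | P rc.1 rc.2]| = (\sum_r \sum_c P r c)%N.
  rewrite -sum1_card pair_big/= big_mkcond/=.
  by apply: eq_bigr => -[r c] _ /=; rewrite inE/=; case: P.
have total : (\sum_r \sum_c (free_entry r c + zero_entry r c +
    (((r != ord0) && (pr r == c)) + (pc c == r))) = d.+1 * k)%N.
  under eq_bigr do under eq_bigr do rewrite entry_split.
  by rewrite !sum_nat_const !card_ord muln1.
move: total; do 3! under eq_bigr do rewrite big_split/=.
rewrite !big_split/= -sumE.
have -> : (\sum_(r < d.+1) \sum_(c < k) ((r != ord0) && (pr r == c)) = d)%N.
  rewrite (eq_bigr (fun r : 'I_d.+1 => (r != ord0) : nat)); last first.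
    move=> r _; rewrite (bigD1 (pr r))//= eqxx andbT big1 ?addn0// => c.
    by rewrite eq_sym => /negPf ->; rewrite andbF.
  by rewrite big_ord_recl eqxx/= add0n sum_nat_const card_ord muln1.
have -> : (\sum_(r < d.+1) \sum_(c < k) (pc c == r) = k)%N.
  rewrite exchange_big/= (eq_bigr (fun=> 1%N)) ?sum1_card ?card_ord// => c _.
  by rewrite (bigD1 (pc c))//= eqxx big1 ?addn0// => r; rewrite eq_sym => /negPf ->.
suff -> : (\sum_(r < d.+1) \sum_(c < k) zero_entry r c = d.+1 * d)%N.
  by rewrite /shape_dim; lia.
rewrite exchange_big/= (eq_bigr (fun c => (fb (pc c) == c) * d)%N); last first.
  move=> c _; rewrite (bigD1 (pc c))//= /zero_entry eqxx add0n.
  rewrite (eq_bigr (fun=> (fb (pc c) == c : nat))); last first.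
    by move=> r; rewrite eq_sym => ->.
  rewrite sum_nat_const mulnC; congr (_ * _)%N.
  by rewrite (eq_card (B := predC1 (pc c))) ?cardC1 ?card_ord.
rewrite -big_distrl/=; congr (_ * _)%N.
rewrite -[RHS]card_ord -(card_codom (can_inj (basis_colK F))) -sum1_card.
rewrite [RHS]big_mkcond/=; apply: eq_bigr => c _.
case: eqP => [<-|fc]; first by rewrite codom_f.
by case: ifPn => // /codomP[j cj]; case: fc; rewrite cj basis_colK.
Qed.

Definition free_pos (i : 'I_shape_dim) : 'I_d.+1 * 'I_k :=
  enum_val (cast_ord (esym card_free_entry) i).

Lemma free_posP i : free_entry (free_pos i).1 (free_pos i).2.
Proof. by have := enum_valP (cast_ord (esym card_free_entry) i); rewrite inE. Qed.

Lemma free_pos_inj : injective free_pos.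
Proof. by move=> i j /enum_val_inj/cast_ord_inj. Qed.

Lemma free_pos_ex r c : free_entry r c -> exists i, free_pos i = (r, c).
Proof.
move=> rc; have rcP : (r, c) \in [pred rc | free_entry rc.1 rc.2] by [].
exists (cast_ord card_free_entry (enum_rank_in rcP (r, c))).
by rewrite /free_pos cast_ordK enum_rankK_in.
Qed.

(** * Scaling a matrix along a frame *)

Section NormalForm.
Variable R : realType.
Local Notation mx := 'M[R]_(d.+1, k).

Definition normal_mx (Y : mx) := forall r c,
  (one_entry r c -> Y r c = 1) /\ (zero_entry r c -> Y r c = 0).

Definition coords (Y : mx) : 'rV[R]_shape_dim :=
  \row_i Y (free_pos i).1 (free_pos i).2.

(** The final 0 is reached only at [zero_entry]s, since [free_pos] enumerates every free entry. *)
Definition embed (y : 'rV[R]_shape_dim) : mx := \matrix_(r, c)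
  if one_entry r c then 1 else
  if [pick i | free_pos i == (r, c)] is Some i then y 0 i else 0.

Lemma embed_normal y : normal_mx (embed y).
Proof.
move=> r c; rewrite mxE; split=> [->//|z].
have n1 : one_entry r c = false.
  have := entry_split r c; rewrite z /one_entry.
  by case: (pc c == r) (_ && _) (free_entry r c) => -[] [].
rewrite n1; case: pickP => // i /eqP e.
by have := free_posP i; rewrite e /free_entry z andbF.
Qed.

Lemma embedK : cancel embed coords.
Proof.
move=> y; apply/rowP => i; rewrite !mxE.
have /andP[/negPf -> _] := free_posP i.
case: pickP => [j /eqP|/(_ i)]; first by rewrite -surjective_pairing => /free_pos_inj ->.
by rewrite -surjective_pairing eqxx.
Qed.

Lemma coordsK Y : normal_mx Y -> embed (coords Y) = Y.
Proof.
move=> nY; apply/matrixP => r c; rewrite mxE; have [Y1 Y0] := nY r c.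
case: ifPn => [/Y1 ->//|n1].
case: pickP => [i /eqP e|no]; first by rewrite mxE e.
rewrite Y0//; apply: contraT => n0.
have [i e] : exists i, free_pos i = (r, c) by apply: free_pos_ex; rewrite /free_entry n1.
by have := no i; rewrite e eqxx.
Qed.

Lemma embed_rational U r c : rational_on U (fun y => embed y r c).
Proof.
pose G (y : 'rV[R]_shape_dim) := if one_entry r c then 1 else
  if [pick i | free_pos i == (r, c)] is Some i then y 0 i else 0.
apply: (@rational_eq _ _ _ _ G) => [y _|]; first by rewrite mxE.
rewrite /G; case: (one_entry r c); first exact: rational_cst.
by case: [pick i | free_pos i == (r, c)] => [i|];
  [exact: rational_coord|exact: rational_cst].
Qed.

(** The recursion climbs from a row to its grandparent row in the tree, up to the root. The fuel
    makes it structural; by [scale_fuelE] the height of the row suffices. *)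
Fixpoint scale_fuel (X : mx) n r : R :=
  if n is n'.+1 then
    if r == ord0 then 1 else
    scale_fuel X n' (pc (pr r)) * X (pc (pr r)) (pr r) / X r (pr r)
  else 1.

(* The factors [a] with [a ord0 = 1] for which row and column scaling turns the
   [one_entry]s into ones. *)
Definition row_scale X r := scale_fuel X (ht r) r.

Lemma scale_fuelE X n r : (ht r <= n)%N -> scale_fuel X n r = row_scale X r.
Proof.
rewrite /row_scale; elim/ltn_ind: n r => -[|n] IH r hr.
  by move: hr; rewrite leqn0 => /eqP ->.
have [->|r0] := eqVneq r ord0; first by case: (ht ord0).
have := row_height_lt F r0; case e: (ht r) => [//|m] /= hm.
have mn : (m <= n)%N by lia.
by rewrite (negPf r0) (IH n)// ?(IH m)//; lia.
Qed.

Lemma row_scale0 X : row_scale X ord0 = 1.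
Proof. by rewrite /row_scale; case: (ht ord0). Qed.

Lemma row_scaleE X r : r != ord0 -> row_scale X r =
  row_scale X (pc (pr r)) * X (pc (pr r)) (pr r) / X r (pr r).
Proof.
move=> r0; have hq := row_height_lt F r0.
rewrite -(@scale_fuelE X (ht r).-1 (pc (pr r))); last by lia.
by rewrite {1}/row_scale; case: (ht r) hq => //= n _; rewrite (negPf r0).
Qed.

(** Induction along the tree, away from the root. *)
Lemma row_ind (P : 'I_d.+1 -> Prop) : P ord0 ->
  (forall r, r != ord0 -> P (pc (pr r)) -> P r) -> forall r, P r.
Proof.
move=> P0 IH r; have [n] := ubnP (ht r); elim: n r => // n IHn r hr.
have [->//|r0] := eqVneq r ord0; apply: IH => //; apply: IHn.
by have := row_height_lt F r0; lia.
Qed.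

Definition in_frame (X : mx) :=
  (forall c, X (pc c) c != 0) /\ (forall r, r != ord0 -> X r (pr r) != 0).

Lemma row_scale_neq0 X r : in_frame X -> row_scale X r != 0.
Proof.
move=> [Xc Xr]; elim/row_ind: r => [|r r0 IH]; first by rewrite row_scale0 oner_eq0.
by rewrite row_scaleE// !mulf_neq0// ?invr_eq0 Xr.
Qed.

(** The column factor makes the entry at [(pc c, c)] equal to 1; the recursion for [row_scale] then
    does the same at [(r, pr r)]. *)
Definition rescale (X : mx) : mx := \matrix_(r, c)
  (row_scale X r * X r c / (X (pc c) c * row_scale X (pc c))).

Definition basis_mx (M : mx) : 'M[R]_d.+1 := \matrix_(r, j) M r (fb j).

Definition basis_coords (M : mx) : mx := invmx (basis_mx M) *m M.

Definition normal_form (M : mx) : mx := rescale (basis_coords M).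

Definition frame_dom : set mx :=
  [set M | basis_mx M \in unitmx /\ in_frame (basis_coords M)].

Lemma basis_coords_basis M r j : basis_mx M \in unitmx ->
  basis_coords M r (fb j) = (r == j)%:R.
Proof.
move=> uB; have /matrixP/(_ r j) := mulVmx uB; rewrite [RHS]mxE => <-.
by rewrite !mxE; apply: eq_bigr => s _; rewrite !mxE.
Qed.

Lemma normal_form_normal M : frame_dom M -> normal_mx (normal_form M).
Proof.
move=> [uB fX] r c; set X := basis_coords M in fX *; have [Xc Xr] := fX.
have a0 s := row_scale_neq0 s fX.
rewrite mxE -/X; split=> [/orP[/eqP<-|/andP[r0 /eqP <-]]|/andP[pcr /eqP fc]].
- by rewrite [row_scale _ _ * _]mulrC mulfV// mulf_neq0.
- rewrite (row_scaleE _ r0) divfK ?Xr// [row_scale _ _ * _]mulrC mulfV//.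
  by rewrite mulf_neq0.
- by rewrite -{1}fc basis_coords_basis// eq_sym (negPf pcr) mulr0 mul0r.
Qed.

(** The basis columns of [Y] already form the identity, and ones along the tree make every scale
    equal to 1. *)
Lemma normal_form_id Y : normal_mx Y -> frame_dom Y /\ normal_form Y = Y.
Proof.
move=> nY.
have B1 : basis_mx Y = 1%:M.
  apply/matrixP => r j; rewrite !mxE; have [Y1 Y0] := nY r (fb j).
  have [rj|rj] := eqVneq r j; first by rewrite Y1// /one_entry basis_colK rj eqxx.
  by rewrite Y0// /zero_entry basis_colK eqxx eq_sym rj.
have XY : basis_coords Y = Y by rewrite /basis_coords B1 invmx1 mul1mx.
have Yc c : Y (pc c) c = 1 by apply: (nY _ _).1; rewrite /one_entry eqxx.
have Yr r : r != ord0 -> Y r (pr r) = 1.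
  by move=> r0; apply: (nY _ _).1; rewrite /one_entry r0 eqxx orbT.
split.
  split; first by rewrite B1 unitmx1.
  rewrite XY; split=> [c|r r0]; first by rewrite Yc oner_neq0.
  by rewrite Yr// oner_neq0.
have a1 r : row_scale Y r = 1.
  elim/row_ind: r => [|r r0 IH]; first exact: row_scale0.
  by rewrite row_scaleE// IH Yc Yr// divr1 mulr1.
rewrite /normal_form XY; apply/matrixP => r c.
by rewrite mxE !a1 Yc !mul1r invr1 mulr1.
Qed.

(** The cancellations needed in [normal_form_invariant]: [p], [q], [s] and [t] stand for values of
    the column factor [e], with [t] belonging to the basis column of the root in this first
    identity. *)
Let row_scale_step (a x y p q s t : R) :
  y != 0 -> p != 0 -> q != 0 -> s != 0 -> t != 0 ->
  a * q / t * (q^-1 * x * p) / (s^-1 * y * p) = a * x / y * s / t.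
Proof. by move=> *; field; do ?[apply/andP; split]. Qed.

Let rescale_step (a b x y p q s t : R) :
  b != 0 -> y != 0 -> p != 0 -> q != 0 -> s != 0 -> t != 0 ->
  a * s / t * (s^-1 * x * p) / (q^-1 * y * p * (b * q / t)) = a * x / (y * b).
Proof. by move=> *; field; do ?[apply/andP; split]. Qed.

(** In the coordinates of the basis columns [A] cancels and [e] remains: column [c] is multiplied by
    [e c] and row [r] divided by [e (fb r)]. The rescaling undoes both. *)
Lemma normal_form_invariant M N (A : 'M[R]_d.+1) (e : 'I_k -> R) :
  A \in unitmx -> (forall i, e i != 0) ->
  (forall i, col i N = e i *: (A *m col i M)) ->
  frame_dom M -> frame_dom N /\ normal_form N = normal_form M.
Proof.
move=> uA e0 NAM [uB fX]; set X := basis_coords M in fX.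
have NE r c : N r c = e c * (A *m M) r c.
  have /colP/(_ r) := NAM c; rewrite !mxE => ->; congr (_ * _).
  by apply: eq_bigr => j _; rewrite mxE.
pose D : 'rV[R]_d.+1 := \row_j e (fb j).
pose DV : 'rV[R]_d.+1 := \row_j (e (fb j))^-1.
have DDV : diag_mx D *m diag_mx DV = 1%:M.
  rewrite mulmx_diag; apply/matrixP => r j; rewrite !mxE.
  by have [->|] := eqVneq; rewrite ?mulr0n// mulfV.
have BN : basis_mx N = A *m basis_mx M *m diag_mx D.
  apply/matrixP => r j; rewrite mul_mx_diag !mxE NE mulrC; congr (_ * _).
  by rewrite !mxE; apply: eq_bigr => s _; rewrite !mxE.
have uD : diag_mx D \in unitmx by case: (mulmx1_unit DDV).
have uBN : basis_mx N \in unitmx by rewrite BN !unitmx_mul uA uB.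
have BNV : invmx (basis_mx N) = diag_mx DV *m invmx (basis_mx M) *m invmx A.
  apply: (can_inj (mulmxK uBN)); rewrite mulVmx// BN !mulmxA.
  rewrite mulmxKV// -[_ *m invmx _ *m _]mulmxA mulVmx// mulmx1.
  by apply/esym/mulmx1C.
have XN r c : basis_coords N r c = (e (fb r))^-1 * X r c * e c.
  have -> : basis_coords N r c = e c * (invmx (basis_mx N) *m (A *m M)) r c.
    rewrite !mxE mulr_sumr; apply: eq_bigr => j _.
    by rewrite NE mulrCA.
  rewrite BNV !mulmxA mulmxKV// -mulmxA -/(basis_coords M) -/X.
  by rewrite mul_diag_mx !mxE mulrC.
have fXN : in_frame (basis_coords N).
  have [Xc Xr] := fX; split=> [c|r r0]; rewrite XN !mulf_neq0 ?invr_eq0//.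
  exact: Xr.
split=> //; have [Xc Xr] := fX.
(* The division by [e (fb ord0)] keeps the factor of the root equal to 1. *)
have aN r : row_scale (basis_coords N) r =
    row_scale X r * e (fb r) / e (fb ord0).
  elim/row_ind: r => [|r r0 IH]; first by rewrite !row_scale0 mul1r mulfV.
  rewrite !(row_scaleE _ r0) IH !XN.
  by apply: row_scale_step => //; exact: Xr.
rewrite /normal_form; apply/matrixP => r c; rewrite [LHS]mxE [RHS]mxE !aN !XN -/X.
by apply: rescale_step => //; exact: row_scale_neq0.
Qed.

Lemma frame_dom_neq0 M : frame_dom M -> nonzero_cols M.
Proof.
move=> [uB [Xc _]] c; apply: contraNneq (Xc c) => M0.
rewrite mxE big1// => j _.
by have /colP/(_ j) := M0; rewrite !mxE => ->; rewrite mulr0.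
Qed.

Lemma normal_mx_neq0 Y : normal_mx Y -> nonzero_cols Y.
Proof. by move=> /normal_form_id[/frame_dom_neq0]. Qed.

Lemma shape_of_normal_form M : frame_dom M -> shape_of (normal_form M) = shape_of M.
Proof.
move=> DM; have nM := normal_form_normal DM; have [uB fX] := DM.
apply/esym/shape_of_eqP; [exact: frame_dom_neq0|exact: normal_mx_neq0|].
set X := basis_coords M in fX; have [Xc Xr] := fX.
have a0 r := row_scale_neq0 r fX.
exists (diag_mx (\row_r row_scale X r) *m invmx (basis_mx M)).
  rewrite unitmx_mul unitmx_inv uB andbT unitmxE det_diag unitfE.
  by apply/prodf_neq0 => r _; rewrite mxE.
move=> c; exists (X (pc c) c * row_scale X (pc c))^-1.
  by rewrite invr_eq0 mulf_neq0.
have colX : invmx (basis_mx M) *m col c M = col c X by rewrite !colE mulmxA.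
apply/colP => r; rewrite -mulmxA colX mul_diag_mx [LHS]mxE [LHS]mxE [RHS]mxE.
rewrite [LHS]mulrC [X in _ = _ * X]mxE; congr (_ * (_ * _)).
  by rewrite [RHS]mxE.
by rewrite [RHS]mxE.
Qed.

(** Thus both the domain of a frame and the normal form descend to shapes. *)
Lemma frame_dom_shape M N : nonzero_cols N -> shape_of N = shape_of M ->
  frame_dom M -> frame_dom N /\ normal_form N = normal_form M.
Proof.
move=> nzN e DM; move: e => /esym/(shape_of_eqP (frame_dom_neq0 DM) nzN)[A uA hA].
apply: (@normal_form_invariant M N A (fun i => sval (cid2 (hA i)))) => // i.
  by case: (cid2 (hA i)).
by case: (cid2 (hA i)).
Qed.

Section Rational.
Variables (a b : nat) (U : set 'M[R]_(a, b)) (M : 'M[R]_(a, b) -> mx).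
Hypothesis rM : forall r c, rational_on U (fun x => M x r c).

(** [M] is a function of a parameter, to cover both a variable matrix and [embed] of chart
    coordinates. *)
Lemma rational_basis_coords : (forall x, U x -> basis_mx (M x) \in unitmx) ->
  forall r c, rational_on U (fun x => basis_coords (M x) r c).
Proof.
move=> uB; apply: rational_mulmx => //; apply: rational_invmx => // r j.
by apply: rational_eq (rM r (fb j)) => x _; rewrite mxE.
Qed.

Lemma rational_normal_form : (forall x, U x -> frame_dom (M x)) ->
  forall r c, rational_on U (fun x => normal_form (M x) r c).
Proof.
move=> DM; have rX := rational_basis_coords (fun x Ux => (DM x Ux).1).
have ra r : rational_on U (fun x => row_scale (basis_coords (M x)) r).
  elim/row_ind: r => [|r r0 IH].
    by apply: rational_eq (rational_cst _ 1) => x _; rewrite row_scale0.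
  apply: (@rational_eq _ _ _ _ (fun x => row_scale (basis_coords (M x)) (pc (pr r)) *
    basis_coords (M x) (pc (pr r)) (pr r) * (basis_coords (M x) r (pr r))^-1)).
    by move=> x Ux; rewrite (row_scaleE _ r0).
  apply: rational_mul; first exact: rational_mul.
  by apply: rational_inv => // x Ux; have [_ [_]] := DM x Ux; apply.
move=> r c; apply: (@rational_eq _ _ _ _ (fun x => row_scale (basis_coords (M x)) r *
    basis_coords (M x) r c * (basis_coords (M x) (pc c) c *
    row_scale (basis_coords (M x)) (pc c))^-1)).
  by move=> x Ux; rewrite [RHS]mxE.
apply: rational_mul; first exact: rational_mul.
apply: rational_inv => [x Ux|]; last exact: rational_mul.
have [_ fX] := DM x Ux; have [Xc _] := fX.
by rewrite mulf_neq0// row_scale_neq0.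
Qed.

End Rational.

(** Two stages: the entries of [basis_coords] are rational only on the open set [B] where the basis
    matrix is invertible, and finitely many of them must stay nonzero. *)
Lemma open_frame_dom : open frame_dom.
Proof.
pose B := [set M : mx | basis_mx M \in unitmx].
have rcoord r c : rational_on setT (fun M : mx => M r c) by exact: rational_coord.
have oB : open B.
  rewrite openE => M BM.
  have rdet : rational_on setT (fun N : mx => \det (basis_mx N)).
    apply: rational_det => r j.
    by apply: rational_eq (rcoord r (fb j)) => x _; rewrite mxE.
  have cdet := rational_continuous openT rdet (I : setT M).
  have dM : \det (basis_mx M) != 0 by move: BM; rewrite /B/= unitmxE unitfE.
  apply: filterS (cvgr_neq0 _ cdet dM) => N.
  by rewrite /B/= unitmxE unitfE.
have near_entry M r c : B M -> basis_coords M r c != 0 ->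
    \forall N \near M, basis_coords N r c != 0.
  move=> BM; have rX : rational_on B (fun N : mx => basis_coords N r c).
    by apply: rational_basis_coords => // r' c'; exact: rational_coord.
  exact: cvgr_neq0 (rational_continuous oB rX BM).
rewrite openE => M [BM [Xc Xr]].
have nB : nbhs M B by apply: open_nbhs_nbhs.
have nc : \forall N \near M, forall c, basis_coords N (pc c) c != 0.
  apply: (@filter_forall _ _ (fun c (N : mx) => basis_coords N (pc c) c != 0) _
    (nbhs_filter M)) => c; exact: near_entry.
have nr : \forall N \near M, forall r, r != ord0 -> basis_coords N r (pr r) != 0.
  apply: (@filter_forall _ _ (fun r (N : mx) => r != ord0 ->
    basis_coords N r (pr r) != 0) _ (nbhs_filter M)) => r.
  have [->|r0] := eqVneq r ord0; first exact: nearW.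
  by apply: filterS (near_entry M r (pr r) BM (Xr r r0)) => N.
by apply: filterS3 nB nc nr => N ? ? ?.
Qed.

End NormalForm.
End Frames.
Arguments frame_dom {d k} F {R}.
Arguments embed {d k} F {R}.

(** * Existence of a frame *)

Section Height.
Variables (T : finType) (root : T) (e : rel T).
Hypothesis conn : forall S : {set T}, root \in S -> S != [set: T]%SET ->
  exists x y, [/\ x \in S, y \notin S & e x y].

(** Connectedness, given as the existence of an edge across every cut, lets a set grow from the
    root; each new vertex is placed one above the neighbour through which it is reached. *)
Lemma connected_height :
  exists h : T -> nat, forall y, y != root -> exists2 x, e x y & (h x < h y)%N.
Proof.
pose good (S : {set T}) (h : T -> nat) := forall y, y \in S -> y != root ->
  exists x, [/\ x \in S, e x y & (h x < h y)%N].
suff [h gh] : exists h, good [set: T]%SET h.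
  by exists h => y y0; have [|x [_ ? ?]] := gh y _ y0; [rewrite inE|exists x].
suff grow n S h : (#|~: S| <= n)%N -> root \in S -> good S h ->
    exists h', good [set: T]%SET h'.
  apply: (grow _ [set root]%SET (fun=> 0%N) (leqnn _)); first by rewrite inE.
  by move=> y; rewrite inE => ->.
elim: n S h => [|n IH] S h Sn S0 gS.
  exists h; suff <- : S = [set: T]%SET by [].
  apply/setP => x; rewrite inE; apply/negPn/negP => xS.
  by move: Sn; rewrite leqn0 cards_eq0 => /eqP/setP/(_ x); rewrite !inE xS.
have [ST|ST] := eqVneq S [set: T]%SET; first by exists h; rewrite -ST.
have [x [y [xS yS xy]]] := conn S0 ST.
apply: (IH (y |: S)%SET (fun z => if z == y then (h x).+1 else h z)).
- rewrite -ltnS; apply: leq_trans Sn; apply: proper_card.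
  apply/fintype.properP; split.
    by apply/fintype.subsetP => z; rewrite !inE negb_or => /andP[].
  by exists y; rewrite !inE ?eqxx.
- by rewrite !inE S0 orbT.
- move=> z; rewrite !inE; have [-> _ _|zy /= zS z0] := eqVneq z y.
    exists x; rewrite inE xS orbT; split=> //.
    by rewrite ifN//; apply: contraNneq yS => <-.
  have [w [wS wz hw]] := gS z zS z0.
  exists w; rewrite inE wS orbT; split=> //.
  by rewrite ifN//; apply: contraNneq yS => <-.
Qed.

End Height.

Section FrameExists.
Variables (R : realType) (d k : nat).
Hypothesis d0 : (0 < d)%N.
Local Notation vec := 'cV[R]_d.+1.
Local Notation mx := 'M[R]_(d.+1, k).

(** If the columns did not span, a nonzero row [u] would annihilate them all. Its kernel is a
    hyperplane, of positive dimension as [d] is positive, and [Tyler_complement] for it and a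
    complement yields a column outside it. *)
Lemma Tyler_basis (M : mx) : Tyler_mx M -> exists fb : 'I_d.+1 -> 'I_k,
  (\matrix_(r, j) M r (fb j) : 'M[R]_d.+1) \in unitmx.
Proof.
move=> TM.
have [full|nfull] := boolP (row_full M^T).
  exists (fullrankfun full); rewrite -unitmx_tr.
  have := fullrowsub_unit full; congr (_ \in unitmx).
  by apply/matrixP => r j; rewrite !mxE.
have : ~~ row_free M.
  by rewrite -row_leq_rank -mxrank_tr -ltnNge ltn_neqAle nfull rank_leq_col.
rewrite -kermx_eq0 => /rowV0Pn[u /sub_kermxP uM u0].
pose f : 'Hom(vec, 'cV[R]_1) := linfun (mulmx u).
have dT : (\dim (lker f) + \dim (limg f) = d.+1)%N.
  by rewrite -{1}(capfv (lker _)) limg_ker_dim dimvf /dim/= muln1.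
have d1 : (\dim (limg f) <= 1)%N.
  by apply: leq_trans (dimvS (subvf _)) _; rewrite dimvf /dim/= muln1.
have i1 : (0 < \dim (limg f))%N.
  rewrite lt0n dimv_eq0; apply: contra u0 => /eqP f0.
  apply/eqP/rowP => r; rewrite mxE.
  have : f (delta_mx r 0) \in limg f by apply: memv_img; rewrite memvf.
  by rewrite f0 memv0 lfunE/= -colE => /eqP/matrixP/(_ 0 0); rewrite !mxE.
have dC : (\dim (lker f) + \dim (lker f)^C = d.+1)%N.
  by rewrite dimv_compl dimvf /dim/= muln1 subnKC//; lia.
have [|i [iK _]] := Tyler_complement TM TM _ dC.
  by move: dT d1 i1; move: (\dim (limg f)) (\dim (lker f)) => b a; lia.
case/negP: iK; rewrite memv_ker lfunE/= colE mulmxA uM.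
by rewrite mul0mx.
Qed.

(* The configuration is not contained in the union of two complementary
   coordinate subspaces. *)
Lemma Tyler_rows_connected (X : mx) (S : {set 'I_d.+1}) : Tyler_mx X ->
  ord0 \in S -> S != [set: 'I_d.+1]%SET ->
  exists r s, [/\ r \in S, s \notin S &
    [exists c, (X r c != 0) && (X s c != 0)]].
Proof.
move=> TX S0 ST.
have [s0 s0S] : exists s, s \notin S.
  apply/existsP; rewrite -negb_forall; apply: contra ST => /forallP h.
  by apply/eqP/setP => s; rewrite h inE.
(* The projection onto the coordinates in [S]. A column outside its kernel has a nonzero entry in
   [S], and one outside its image a nonzero entry off [S]. *)
pose P : 'M[R]_d.+1 := diag_mx (\row_r (r \in S)%:R).
have PE (v : vec) r : (P *m v) r 0 = (r \in S)%:R * v r 0.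
  by rewrite mul_diag_mx !mxE.
have dT : (\dim (limg (lmx P)) + \dim (lker (lmx P)) = d.+1)%N.
  by rewrite addnC -{1}(capfv (lker _)) limg_ker_dim dimvf /dim/= muln1.
have i0 : (0 < \dim (limg (lmx P)))%N.
  rewrite lt0n dimv_eq0; apply/eqP => im0.
  have : lmx P (delta_mx ord0 0) \in limg (lmx P) by apply: memv_img; rewrite memvf.
  rewrite im0 memv0 lfunE/= => /eqP/matrixP/(_ ord0 0).
  by rewrite PE S0 !mxE !eqxx mulr1 => /eqP; rewrite oner_eq0.
have k0 : (0 < \dim (lker (lmx P)))%N.
  rewrite lt0n dimv_eq0; apply/eqP => ker0.
  have : delta_mx s0 0 \in lker (lmx P).
    rewrite memv_ker lfunE/=; apply/eqP/matrixP => r j; rewrite ord1 PE !mxE.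
    have [->|] := eqVneq r s0; last by rewrite mulr0.
    by rewrite (negPf s0S) mul0r.
  rewrite ker0 memv0 => /eqP/matrixP/(_ s0 0).
  by rewrite !mxE !eqxx => /eqP; rewrite oner_eq0.
have [|c [cI cK]] := Tyler_complement TX TX _ dT.
  by move: dT i0 k0; move: (\dim (limg _)) (\dim (lker _)) => b a; lia.
have [r rS Xr] : exists2 r, r \in S & X r c != 0.
  apply/exists_inP; apply: contraNT cK => /exists_inPn h.
  rewrite memv_ker lfunE/=; apply/eqP/matrixP => r j; rewrite ord1 PE !mxE.
  case: (boolP (r \in S)) => rS; last by rewrite mul0r.
  by have /negPn/eqP -> := h r rS; rewrite mulr0.
have [s sS Xs] : exists2 s, s \notin S & X s c != 0.
  apply/exists_inP; apply: contraNT cI => /exists_inPn h.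
  have -> : col c X = lmx P (col c X).
    rewrite lfunE/=; apply/matrixP => r' j; rewrite ord1 PE.
    case: (boolP (r' \in S)) => rS'; first by rewrite mul1r.
    by have /negPn/eqP := h r' rS'; rewrite mul0r mxE.
  by apply: memv_img; rewrite memvf.
by exists r, s; split=> //; apply/existsP; exists c; rewrite Xr.
Qed.

Lemma frame_ex (M : mx) : Tyler_lifts M -> exists F : frame d k, frame_dom F M.
Proof.
move=> [nzM TM]; have [fb uB] := Tyler_basis TM.
set B := (\matrix_(_, _) _) in uB.
pose X := invmx B *m M.
have colX c : col c X = invmx B *m col c M by rewrite !colE mulmxA.
have nzX : nonzero_cols X.
  move=> c; rewrite colX; apply: contraNneq (nzM c) => e.
  by rewrite -[col c M](mulKVmx uB) e mulmx0.
have TX : Tyler_mx X.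
  apply/(Tyler_shape_of nzX).
  rewrite -(_ : shape_of M = shape_of X); first exact/Tyler_shape_of.
  apply/shape_of_eqP => //; exists (invmx B); first by rewrite unitmx_inv.
  by move=> i; exists 1; rewrite ?oner_neq0 ?scale1r.
have Xfb r j : X r (fb j) = (r == j)%:R.
  have /matrixP/(_ r j) := mulVmx uB; rewrite [RHS]mxE => <-.
  by rewrite !mxE; apply: eq_bigr => s _; rewrite !mxE.
have [h hP] := connected_height (fun S => @Tyler_rows_connected X S TX).
(* The parent of a column is a lowest row meeting it. The parent of a row is then a column shared
   with a lower row, whose own parent is at least as low. *)
have /boolp.choice[pc pcP] : forall c, exists r,
    X r c != 0 /\ forall s, X s c != 0 -> (h r <= h s)%N.
  move=> c; have /cV0Pn[r0] := nzX c; rewrite mxE => Xr0.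
  by have [r Xr rmin] := @arg_minnP _ r0 (fun r => X r c != 0) h Xr0; exists r.
have /boolp.choice[pr prP] : forall r, exists c, r != ord0 ->
    X r c != 0 /\ (h (pc c) < h r)%N.
  move=> r; have [r0|r0] := eqVneq r ord0; first by exists (fb ord0).
  have [s /existsP[c /andP[Xs Xr]] hs] := hP r r0.
  by exists c => _; split=> //; apply: leq_ltn_trans hs; apply: (pcP c).2.
have fbK : cancel fb pc.
  move=> j; have [+ _] := pcP (fb j).
  by rewrite Xfb pnatr_eq0 eqb0 negbK => /eqP.
(* The column [fb j] meets row [j] only, so as parent of [r] it would force [r = j = pc (pr r)],
   against the strict drop in height. *)
have pr_fb r j : r != ord0 -> pr r != fb j.
  move=> r0; have [Xr hr] := prP r r0; apply/eqP => e.
  by move: Xr hr; rewrite e Xfb fbK pnatr_eq0 eqb0 negbK => /eqP->; rewrite ltnn.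
have ht_lt r : r != ord0 -> (h (pc (pr r)) < h r)%N.
  by move=> r0; have [] := prP r r0.
exists (Frame fbK pr_fb ht_lt); split; first exact: uB.
split=> [c|r r0]; first exact: (pcP c).1.
by have [] := prP r r0.
Qed.

End FrameExists.

(** * Charts *)

Section Charts.
Variables (R : realType) (d k : nat).
Local Notation mx := 'M[R]_(d.+1, k).
Local Notation Tyler := (Tyler_space R d k).
Local Notation n := (shape_dim d k).

Section FrameChart.
Variables (F : frame d k) (t0 : Tyler).

Definition fchart_dom : set Tyler :=
  shape_val @^-1` (shape_of @` (frame_dom F : set mx)).

Definition fchart_map (t : Tyler) : 'rV[R]_n :=
  coords F (normal_form F (lift_shape (shape_val t))).

(** Off [fchart_cod] no Tyler regular shape has the lift [embed F y]; the value is then the default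
    [t0]. *)
Definition fchart_inv (y : 'rV[R]_n) : Tyler :=
  xget t0 [set t | shape_val t = shape_of (embed F y)].

Definition fchart_cod : set 'rV[R]_n :=
  [set y | Tyler_lifts (embed F y : mx)].

Lemma fchart_domP t M : nonzero_cols M -> shape_of M = shape_val t ->
  fchart_dom t <-> frame_dom F M.
Proof.
move=> nzM Mt; split=> [[N DN Nt]|DM]; last by exists M.
by apply: (frame_dom_shape nzM _ DN).1; rewrite Mt.
Qed.

Lemma fchart_mapE t M : frame_dom F M -> shape_of M = shape_val t ->
  fchart_map t = coords F (normal_form F M).
Proof.
move=> DM Mt; congr coords.
have [|_ //] := frame_dom_shape (@lift_shape_neq0 R d k (shape_val t)) _ DM.
by rewrite lift_shapeK.
Qed.

Lemma fchart_invE y : fchart_cod y ->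
  shape_val (fchart_inv y) = shape_of (embed F y).
Proof.
move=> /Tyler_space_ex[t ht].
exact: (@xgetPex _ t0 [set t | shape_val t = shape_of (embed F y)] (ex_intro _ t ht)).
Qed.

Lemma embed_frame_dom y : frame_dom F (embed F y : mx).
Proof. by have [] := normal_form_id (embed_normal F y). Qed.

Lemma fchart_inv_dom y : fchart_cod y -> fchart_dom (fchart_inv y).
Proof. by move=> yc; exists (embed F y); [exact: embed_frame_dom|rewrite fchart_invE]. Qed.

Lemma fchart_invK y : fchart_cod y -> fchart_map (fchart_inv y) = y.
Proof.
move=> yc; rewrite (@fchart_mapE _ (embed F y)) ?fchart_invE//; last exact: embed_frame_dom.
by have [_ ->] := normal_form_id (embed_normal F y); rewrite embedK.
Qed.

Lemma shape_of_embed_map t : fchart_dom t ->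
  shape_of (embed F (fchart_map t)) = shape_val t.
Proof.
move=> [M DM Mt]; rewrite (fchart_mapE DM Mt) coordsK; last exact: normal_form_normal.
by rewrite shape_of_normal_form.
Qed.

Lemma fchart_map_cod t : fchart_dom t -> fchart_cod (fchart_map t).
Proof.
move=> Dt; have nz := frame_dom_neq0 (embed_frame_dom (fchart_map t)).
split=> //; apply/(Tyler_shape_of nz); rewrite shape_of_embed_map//.
by rewrite /shape_val set_valE; apply: set_mem; exact: (valP t).
Qed.

Lemma fchart_image : fchart_map @` fchart_dom = fchart_cod.
Proof.
apply/seteqP; split=> [_ [t Dt <-]|y yc]; first exact: fchart_map_cod.
by exists (fchart_inv y); [exact: fchart_inv_dom|exact: fchart_invK].
Qed.

Lemma fchart_mapK : {in fchart_dom, cancel fchart_map fchart_inv}.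
Proof.
move=> t /set_mem Dt; apply: shape_val_inj.
by rewrite fchart_invE ?shape_of_embed_map//; exact: fchart_map_cod.
Qed.

Lemma fchart_dom_open : open fchart_dom.
Proof.
apply: open_comp; first by move=> t _; exact: shape_val_continuous.
by apply: shape_of_open; [exact: frame_dom_neq0|exact: open_frame_dom].
Qed.

Lemma embed_continuous : continuous (embed F : 'rV[R]_n -> mx).
Proof.
move=> y; apply: (@rational_mx_continuous R _ _ setT) => //; first exact: openT.
by move=> r c; exact: embed_rational.
Qed.

Lemma fchart_cod_open : open fchart_cod.
Proof. by apply: open_comp (@open_Tyler_lifts R d k) => y _; exact: embed_continuous. Qed.

(** The lift chosen in [fchart_map] need not vary continuously. Continuity is obtained for the
    normal form of matrices and brought down by the openness of [shape_of]. *)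
Lemma fchart_map_continuous : {within fchart_dom, continuous fchart_map}.
Proof.
rewrite continuous_open_subspace; last exact: fchart_dom_open.
move=> t /set_mem [M DM Mt] A nA.
have cNF : {for M, continuous (fun N : mx => coords F (normal_form F N))}.
  apply: (@rational_mx_continuous R _ _ (frame_dom F)) => //; first exact: open_frame_dom.
  move=> i j; rewrite (_ : (fun _ => _) = fun N : mx =>
    normal_form F N (free_pos F j).1 (free_pos F j).2); last first.
    by apply/funext => N; rewrite mxE.
  by apply: rational_normal_form => // r c; exact: rational_coord.
have : nbhs M ((fun N : mx => coords F (normal_form F N)) @^-1` A).
  by apply: cNF; rewrite -(fchart_mapE DM Mt).
rewrite nbhsE => -[V [oV VM] VA].
have oQ : open (shape_of @` (V `&` (frame_dom F : set mx))).
  apply: shape_of_open; first by move=> N [_ /frame_dom_neq0].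
  by apply: openI => //; exact: open_frame_dom.
have : nbhs t (shape_val @^-1` (shape_of @` (V `&` (frame_dom F : set mx)))).
  apply: shape_val_continuous; apply: open_nbhs_nbhs; split=> //.
  by exists M.
apply: filterS => s [N [VN DN] Ns].
by rewrite /= (fchart_mapE DN Ns); exact: VA.
Qed.

Lemma fchart_inv_continuous :
  {within fchart_map @` fchart_dom, continuous fchart_inv}.
Proof.
rewrite fchart_image continuous_open_subspace; last exact: fchart_cod_open.
move=> y /set_mem yc A [_ [[W oW <-] Wy WA]].
have ncod : nbhs y fchart_cod.
  by apply: open_nbhs_nbhs; split=> //; exact: fchart_cod_open.
have nW : nbhs y (fun z => W (shape_of (embed F z))).
  have nz := frame_dom_neq0 (embed_frame_dom y).
  apply: (continuous_comp (@embed_continuous y) (shape_of_continuous nz)).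
  by apply: open_nbhs_nbhs; split=> //=; rewrite -fchart_invE.
apply: filterS2 ncod nW => z zc Wz; apply: WA.
by rewrite /= -/(shape_val _) fchart_invE.
Qed.

Definition fchart : chart R Tyler n.
Proof.
refine (@Chart R Tyler n fchart_dom fchart_map fchart_inv fchart_dom_open _
  fchart_map_continuous fchart_inv_continuous fchart_mapK).
by rewrite fchart_image; exact: fchart_cod_open.
Defined.

End FrameChart.

Lemma fchart_transition (F G : frame d k) (s t : Tyler) :
  smooth_transition (fchart F s) (fchart G t).
Proof.
rewrite /smooth_transition /=.
(* In the coordinates of [F] the overlap consists of the [y] whose embedded matrix also lies in the
   domain of [G]; there the transition reads off its normal form for [G]. *)
set V := [set y | fchart_cod F y /\ frame_dom G (embed F y : mx)].
have EV : fchart_map F @` (fchart_dom F `&` fchart_dom G) = V.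
  apply/seteqP; split=> [_ [u [Fu Gu] <-]|y [yc Gy]].
    split; first exact: fchart_map_cod.
    apply/(@fchart_domP G u) => //; last exact: shape_of_embed_map.
    exact: frame_dom_neq0 (embed_frame_dom _ _).
  exists (fchart_inv F s y); last exact: fchart_invK.
  split; first exact: fchart_inv_dom.
  by exists (embed F y) => //; rewrite fchart_invE.
rewrite EV; apply: rational_smooth.
  apply: openI; first exact: fchart_cod_open.
  by apply: open_comp (@open_frame_dom _ _ G R) => y _; exact: embed_continuous.
move=> j; apply: (@rational_eq _ _ _ _ (fun y : 'rV[R]_n =>
    normal_form G (embed F y) (free_pos G j).1 (free_pos G j).2)).
  move=> y [yc Gy]; rewrite /= (@fchart_mapE G _ (embed F y)) ?fchart_invE//.
  by rewrite [RHS]mxE.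
apply: rational_normal_form => [r c|y [_]//].
exact: embed_rational.
Qed.

End Charts.

Theorem mainTheorem6 (R : realType) (d k : nat)
    (hd : (1 <= d)%N) (hk : (d + 3 <= k)%N) :
  differentiable_manifold R (Tyler_space R d k) /\
  hausdorff_space (Tyler_space R d k).
Proof.
split; last exact: Tyler_space_hausdorff.
have cover (t : Tyler_space R d k) : exists F, fchart_dom F t.
  have [F DF] := frame_ex hd (lift_shape_Tyler t).
  by exists F; exists (lift_shape (shape_val t)) => //; exact: lift_shapeK.
split; first exact: Tyler_space_second_countable.
exists (shape_dim d k); split.
  by move=> t; have [F Ft] := cover t; exists (fchart F t).
exists [set c | exists F t, c = fchart F t]; split.
  by move=> t; have [F Ft] := cover t; exists (fchart F t) => //; exists F, t.
by move=> _ _ [F [s ->]] [G [t ->]]; exact: fchart_transition.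
Qed.
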